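(* Consider the no-show model described in the context, with $\epsilon>0$ and data $\widehat{\boldsymbol\xi}^j=(\widehat{\boldsymbol\mu}^j,\widehat{\boldsymbol\lambda}^j)\in\Xi$, $j\in[N]$. (i) If $p=1$, then W-NS has the same optimal value and the same optimal solutions $\mathbf s$ as the copositive program $$\widehat Z_{NS}(N,\epsilon)=\inf\ \epsilon\rho+\frac1N\sum_{j=1}^N\beta_j$$ over $\rho\in\mathbb R$, $\boldsymbol\beta\in\mathbb R^N$, $\boldsymbol\psi,\boldsymbol\phi\in\mathbb R^{n\times N}$, $\mathbf s$, subject to $\beta_j\mathbf e_1\mathbf e_1^\top+\sum_{i=1}^n\psi_{ij}\mathbf M_i+\sum_{i=1}^n\phi_{ij}\mathbf J_i-\mathbf G^1_j(\rho,\mathbf s)\in\mathcal{COP}(\mathcal K^j_{NS,1})$ for all $j\in[N]$, $\rho\ge0$, $\mathbf s\in\mathcal S$ (here $\mathbf e_1\in\mathbb R^{5n+1}$). (ii) If $p=2$, then W-NS has the same optimal value and the same optimal solutions $\mathbf s$ as the copositive program $$\widehat Z_{NS}(N,\epsilon)=\inf\ \epsilon^2\rho+\frac1N\sum_{j=1}^N\beta_j$$ over $\rho\in\mathbb R$, $\boldsymbol\beta\in\mathbb R^N$, $\boldsymbol\psi\in\mathbb R^{n\times N}$, $\mathbf s$, subject to $\beta_j\mathbf e_1\mathbf e_1^\top+\sum_{i=1}^n\psi_{ij}\mathbf N_i-\mathbf G^2_j(\rho,\mathbf s)\in\mathcal{COP}(\mathcal K_{NS,2})$ for all $j\in[N]$,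 $\rho\ge0$, $\mathbf s\in\mathcal S$ (here $\mathbf e_1\in\mathbb R^{3n+1}$).
   Context: Notation: $[m]=\{1,\dots,m\}$, $[i,j]_{\mathbb Z}=\{i,\dots,j\}$, $\mathbf e$ all-ones vector, $\mathbf e_i$ $i$-th standard basis vector, $\mathbf I$ identity, $\mathbb S^k$ symmetric $k\times k$ matrices. Data: $n,N\ge1$, $T>0$, $\mathcal S=\{\mathbf s\in\mathbb R^n:\mathbf s\ge0,\sum_is_i\le T\}$, costs $\mathbf c,\mathbf d\in\mathbb R^n_+$, $C\ge0$ with $d_{i+1}-d_i\le c_{i+1}$ ($i\in[n-1]$), bounds $0\le u^L_i<u^U_i<\infty$, an integer $K\in[n]$. $\Lambda=\{\boldsymbol\lambda\in\{0,1\}^n:\sum_i(1-\lambda_i)\le K\}$, $\Xi=\{(\boldsymbol\mu,\boldsymbol\lambda)\in\mathbb R^n\times\Lambda:u^L_i\lambda_i\le\mu_i\le u^U_i\lambda_i\ \forall i\}$. For $\boldsymbol\xi=(\boldsymbol\mu,\boldsymbol\lambda)\in\Xi$, $g(\mathbf s,\boldsymbol\xi)$ is the optimal value of $\min_{\mathbf w\in\mathbb R^{n+1},\mathbf v\in\mathbb R^n}\sum_{i=1}^n(c_i\lambda_iw_i+d_iv_i)+Cw_{n+1}$ s.t. $w_i-v_{i-1}=\mu_{i-1}+w_{i-1}-s_{i-1}$ ($i\in[2,n+1]_{\mathbb Z}$), $\mathbf w\ge0,w_1=0,\mathbf v\ge0$. For $p\ge1$, $d_p$ is the $p$-Wasserstein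 distance on distributions over $\Xi\subseteq\mathbb R^{2n}$ with cost $\|\cdot\|_p^p$ (i.e. $d_p(\mathbb Q_1,\mathbb Q_2)=(\inf_\Pi\mathbb E_\Pi\|\boldsymbol\xi_1-\boldsymbol\xi_2\|_p^p)^{1/p}$ over couplings); $\widehat{\mathbb P}^N=\frac1N\sum_j\delta_{\widehat{\boldsymbol\xi}^j}$; $\mathcal D_p(\widehat{\mathbb P}^N,\epsilon)$ is the set of distributions $\mathbb Q$ on $\Xi$ with $d_p(\mathbb Q,\widehat{\mathbb P}^N)\le\epsilon$; W-NS is $\widehat Z_{NS}(N,\epsilon)=\min_{\mathbf s\in\mathcal S}\sup_{\mathbb Q\in\mathcal D_p}\mathbb E_{\mathbb Q}[g(\mathbf s,\boldsymbol\xi)]$. For $\boldsymbol\lambda\in\mathbb R^n$, $\mathcal Y(\boldsymbol\lambda)=\{\mathbf y\in\mathbb R^n:-y_i\le d_i\ \forall i;\ y_{i-1}-y_i\le c_i\lambda_i\ \forall i\in[2,n]_{\mathbb Z};\ y_n\le C\}$. $\mathcal F^j_{NS,1}$ is the set of $(\boldsymbol\mu^+,\boldsymbol\mu^-,\boldsymbol\lambda^+,\boldsymbol\lambda^-,\mathbf y)\in\mathbb R^{5n}$ with $\boldsymbol\mu^\pm,\boldsymbol\lambda^\pm\ge0$, $0\le\boldsymbol\lambda^+-\boldsymbol\lambda^-+\widehat{\boldsymbol\lambda}^j\le\mathbf e$, $\boldsymbol\lambda^+\le\mathbf e$, $\boldsymbol\lambda^-\le\mathbf e$, $\sum_i[1-(\lambda^+_i-\lambda^-_i+\widehat\lambda^j_i)]\le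 K$, $u^L_i(\lambda^+_i-\lambda^-_i+\widehat\lambda^j_i)\le\mu^+_i-\mu^-_i+\widehat\mu^j_i\le u^U_i(\lambda^+_i-\lambda^-_i+\widehat\lambda^j_i)$ for all $i$, $y_n\le C$, $-y_i\le d_i$ for all $i$, $y_{i-1}-y_i\le c_i(\lambda^+_i-\lambda^-_i+\widehat\lambda^j_i)$ for $i\in[2,n]_{\mathbb Z}$. $\mathcal F_{NS,2}$ is the set of $(\boldsymbol\mu,\boldsymbol\lambda,\mathbf y)\in\mathbb R^{3n}$ with $\mathbf y\in\mathcal Y(\boldsymbol\lambda)$, $\sum_i(1-\lambda_i)\le K$, $0\le\boldsymbol\lambda\le\mathbf e$, $u^L_i\lambda_i\le\mu_i\le u^U_i\lambda_i$ for all $i$. Perspective cones: $\mathcal K^j_{NS,1}=\mathrm{closure}\{(t,\mathbf x):\mathbf x/t\in\mathcal F^j_{NS,1},t>0\}\subseteq\mathbb R^{5n+1}$, $\mathcal K_{NS,2}=\mathrm{closure}\{(t,\mathbf x):\mathbf x/t\in\mathcal F_{NS,2},t>0\}\subseteq\mathbb R^{3n+1}$. For a closed convex cone $\mathcal K\subseteq\mathbb R^k$, $\mathcal{COP}(\mathcal K)=\{\mathbf M\in\mathbb S^k:\mathbf x^\top\mathbf M\mathbf x\ge0\ \forall\mathbf x\in\mathcal K\}$. Matrices in $\mathbb S^{5n+1}$ with blocks of sizes $(1,n,n,n,n,n)$ corresponding to $(t,\boldsymbol\mu^+,\boldsymbol\mu^-,\boldsymbol\lambda^+,\boldsymbol\lambda^-,\mathbf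 y)$: $\mathbf G^1_j(\rho,\mathbf s)$ has first row $(0,-\tfrac12\rho\mathbf e^\top,-\tfrac12\rho\mathbf e^\top,-\tfrac12\rho\mathbf e^\top,-\tfrac12\rho\mathbf e^\top,\tfrac12(\widehat{\boldsymbol\mu}^j-\mathbf s)^\top)$ and the symmetric first column, the $(\boldsymbol\mu^+,\mathbf y)$ and $(\mathbf y,\boldsymbol\mu^+)$ blocks equal $\tfrac12\mathbf I$, the $(\boldsymbol\mu^-,\mathbf y)$ and $(\mathbf y,\boldsymbol\mu^-)$ blocks equal $-\tfrac12\mathbf I$, and all other blocks zero. With $\mathbf a_i\in\mathbb R^{5n+1}$ having $\mathbf e_i$ in the $\boldsymbol\lambda^+$ block and zeros elsewhere, $\mathbf b_i$ having $\mathbf e_i$ in the $\boldsymbol\lambda^-$ block, and $\mathbf e_1$ the first basis vector: $\mathbf J_i=\mathbf a_i\mathbf a_i^\top-\tfrac12\mathbf a_i\mathbf e_1^\top-\tfrac12\mathbf e_1\mathbf a_i^\top$, $\mathbf M_i=\mathbf b_i\mathbf b_i^\top-\tfrac12\mathbf b_i\mathbf e_1^\top-\tfrac12\mathbf e_1\mathbf b_i^\top$. Matrices in $\mathbb S^{3n+1}$ with blocks $(1,n,n,n)$ corresponding to $(t,\boldsymbol\mu,\boldsymbol\lambda,\mathbf y)$: $$\mathbf G^2_j(\rho,\mathbf s)=\begin{bmatrix}-\rho(\|\widehat{\boldsymbol\mu}^j\|_2^2+\|\widehat{\boldsymbol\lambda}^j\|_2^2)&\rho(\widehat{\boldsymbol\mu}^j)^\top&\rho(\widehat{\boldsymbol\lambda}^j)^\top&-\tfrac12\mathbf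 s^\top\\\rho\widehat{\boldsymbol\mu}^j&-\rho\mathbf I&0&\tfrac12\mathbf I\\\rho\widehat{\boldsymbol\lambda}^j&0&-\rho\mathbf I&0\\-\tfrac12\mathbf s&\tfrac12\mathbf I&0&0\end{bmatrix},$$ and with $\mathbf c_i\in\mathbb R^{3n+1}$ having $\mathbf e_i$ in the $\boldsymbol\lambda$ block, $\mathbf N_i=\mathbf c_i\mathbf c_i^\top-\tfrac12\mathbf c_i\mathbf e_1^\top-\tfrac12\mathbf e_1\mathbf c_i^\top$. *)

(* Defs.v *)
From HB Require Import structures.
From mathcomp Require Import all_boot all_order all_algebra.
From mathcomp Require Import all_classical all_reals all_analysis.

Set Implicit Arguments.
Unset Strict Implicit.
Unset Printing Implicit Defensive.

Import Order.TTheory GRing.Theory Num.Theory.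
Import numFieldNormedType.Exports.
Local Open Scope classical_set_scope.
Local Open Scope ring_scope.

(* An uncertain realization xi = (mu, lambda) in R^n x R^n = R^{2n},
   encoded as a pair of n-tuples (product sigma-algebra = Borel sigma-algebra). *)
Notation XiT R n := ((n.-tuple R) * (n.-tuple R))%type.

Definition xmu {R : realType} {n : nat} (x : XiT R n) (i : 'I_n) : R := tnth x.1 i.
Definition xlam {R : realType} {n : nat} (x : XiT R n) (i : 'I_n) : R := tnth x.2 i.

Definition inLambda {R : realType} {n : nat} (K : nat) (lam : 'I_n -> R) : Prop :=
  (forall i, lam i = 0 \/ lam i = 1) /\ \sum_(i < n) (1 - lam i) <= K%:R.

Definition inXi {R : realType} {n : nat} (K : nat) (uL uU : 'I_n -> R)
  (x : XiT R n) : Prop :=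
  inLambda K (xlam x) /\
  (forall i, uL i * xlam x i <= xmu x i /\ xmu x i <= uU i * xlam x i).

Definition inS {R : realType} {n : nat} (Tcap : R) (s : 'I_n -> R) : Prop :=
  (forall i, 0 <= s i) /\ \sum_(i < n) s i <= Tcap.

(* Second-stage value g(s, xi).  w = (w_1,...,w_{n+1}) is indexed by 'I_n.+1
   (w (widen i) = w_{i+1}, w (lift ord0 i) = w_{i+2}), v = (v_1..v_n) by 'I_n. *)
Definition g_feas {R : realType} {n : nat} (s : 'I_n -> R) (x : XiT R n)
  (w : 'I_n.+1 -> R) (v : 'I_n -> R) : Prop :=
  (forall i : 'I_n, w (lift ord0 i) - v i = xmu x i + w (widen_ord (leqnSn n) i) - s i)
  /\ (forall k, 0 <= w k) /\ w ord0 = 0 /\ (forall i, 0 <= v i).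

Definition g_obj {R : realType} {n : nat} (c d : 'I_n -> R) (C : R) (x : XiT R n)
  (w : 'I_n.+1 -> R) (v : 'I_n -> R) : R :=
  \sum_(i < n) (c i * xlam x i * w (widen_ord (leqnSn n) i) + d i * v i)
  + C * w ord_max.

Definition gval {R : realType} {n : nat} (c d : 'I_n -> R) (C : R)
  (s : 'I_n -> R) (x : XiT R n) : \bar R :=
  ereal_inf [set z | exists w v, g_feas s x w v /\ z = (g_obj c d C x w v)%:E].

Definition costp {R : realType} {n : nat} (p : nat) (x y : XiT R n) : R :=
  \sum_(i < n) `|xmu x i - xmu y i| ^+ p + \sum_(i < n) `|xlam x i - xlam y i| ^+ p.

Definition coupling {R : realType} {n : nat}
  (P : probability (XiT R n * XiT R n)%type R) (Q1 Q2 : set (XiT R n) -> \bar R) : Prop :=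
  forall A : set (XiT R n), measurable A ->
    P (A `*` setT) = Q1 A /\ P (setT `*` A) = Q2 A.

Definition wdist {R : realType} {n : nat} (p : nat)
  (Q1 Q2 : set (XiT R n) -> \bar R) : \bar R :=
  poweR (ereal_inf [set z | exists P : probability (XiT R n * XiT R n)%type R,
            coupling P Q1 Q2 /\ z = (\int[P]_y (costp p y.1 y.2)%:E)%E])
        (p%:R^-1).

Definition empirical {R : realType} {n N : nat} (xihat : 'I_N -> XiT R n)
  (A : set (XiT R n)) : \bar R :=
  ((N%:R^-1)%:E * \sum_(j < N) \d_(xihat j) A)%E.

Definition inBall {R : realType} {n N : nat} (K : nat) (uL uU : 'I_n -> R)
  (xihat : 'I_N -> XiT R n) (p : nat) (eps : R) (Q : probability (XiT R n) R) : Prop :=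
  Q (inXi K uL uU) = 1%E /\ (wdist p Q (empirical xihat) <= eps%:E)%E.

Definition worst {R : realType} {n N : nat} (c d : 'I_n -> R) (C : R) (K : nat)
  (uL uU : 'I_n -> R) (xihat : 'I_N -> XiT R n) (p : nat) (eps : R)
  (s : 'I_n -> R) : \bar R :=
  ereal_sup [set z | exists Q : probability (XiT R n) R,
    inBall K uL uU xihat p eps Q /\ z = (\int[Q]_x gval c d C s x)%E].

Definition Z_WNS {R : realType} {n N : nat} (Tcap : R) (c d : 'I_n -> R) (C : R)
  (K : nat) (uL uU : 'I_n -> R) (xihat : 'I_N -> XiT R n) (p : nat) (eps : R) : \bar R :=
  ereal_inf [set z | exists s, inS Tcap s /\ z = worst c d C K uL uU xihat p eps s].

Definition WNS_opt {R : realType} {n N : nat} (Tcap : R) (c d : 'I_n -> R) (C : R)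
  (K : nat) (uL uU : 'I_n -> R) (xihat : 'I_N -> XiT R n) (p : nat) (eps : R)
  (s : 'I_n -> R) : Prop :=
  inS Tcap s /\ worst c d C K uL uU xihat p eps s = Z_WNS Tcap c d C K uL uU xihat p eps.

Definition inY {R : realType} {n : nat} (c d : 'I_n -> R) (C : R)
  (lam : 'I_n -> R) (y : 'I_n -> R) : Prop :=
  (forall i, - y i <= d i) /\
  (forall i k : 'I_n, k.+1 = i :> nat -> y k - y i <= c i * lam i) /\
  (forall i : 'I_n, i.+1 = n -> y i <= C).

(* index of component r of the b-th block (b = 0,1,...) in a vector (t, x_0, x_1, ...)
   of R^{m n + 1}; index 0 is the t-coordinate *)
Definition bix {n : nat} (m b : nat) (r : 'I_n) : 'I_(m * n).+1 := inord (1 + b * n + r).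

Definition comp {R : realType} {n m : nat} (v : 'cV[R]_((m * n).+1)) (b : nat) (r : 'I_n) : R :=
  v (bix m b r) ord0.

Definition inF1 {R : realType} {n N : nat} (c d : 'I_n -> R) (C : R) (K : nat)
  (uL uU : 'I_n -> R) (xihat : 'I_N -> XiT R n) (j : 'I_N) (v : 'cV[R]_((5 * n).+1)) : Prop :=
  let mup := comp v 0 in let mum := comp v 1 in
  let lap := comp v 2 in let lam := comp v 3 in let y := comp v 4 in
  let la := fun i => lap i - lam i + xlam (xihat j) i in
  let mu := fun i => mup i - mum i + xmu (xihat j) i in
  (forall i, 0 <= mup i /\ 0 <= mum i /\ 0 <= lap i /\ 0 <= lam i) /\
  (forall i, 0 <= la i <= 1) /\
  (forall i, lap i <= 1 /\ lam i <= 1) /\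
  \sum_(i < n) (1 - la i) <= K%:R /\
  (forall i, uL i * la i <= mu i /\ mu i <= uU i * la i) /\
  (forall i : 'I_n, i.+1 = n -> y i <= C) /\
  (forall i, - y i <= d i) /\
  (forall i k : 'I_n, k.+1 = i :> nat -> y k - y i <= c i * la i).

Definition inF2 {R : realType} {n : nat} (c d : 'I_n -> R) (C : R) (K : nat)
  (uL uU : 'I_n -> R) (v : 'cV[R]_((3 * n).+1)) : Prop :=
  let mu := comp v 0 in let la := comp v 1 in let y := comp v 2 in
  inY c d C la y /\ \sum_(i < n) (1 - la i) <= K%:R /\
  (forall i, 0 <= la i <= 1) /\
  (forall i, uL i * la i <= mu i /\ mu i <= uU i * la i).

Definition persp {R : realType} {k : nat} (F : 'cV[R]_k.+1 -> Prop) : set 'cV[R]_k.+1 :=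
  closure [set v : 'cV[R]_k.+1 | 0 < v ord0 ord0 /\ F ((v ord0 ord0)^-1 *: v)].

Definition COP {R : realType} {k : nat} (Kc : set 'cV[R]_k) : set 'M[R]_k :=
  [set M | M^T = M /\ forall x, Kc x -> 0 <= (x^T *m M *m x) ord0 ord0].

Definition e1v {R : realType} {k : nat} : 'cV[R]_k.+1 := delta_mx ord0 ord0.

Definition Jmat {R : realType} {k : nat} (a : 'cV[R]_k.+1) : 'M[R]_k.+1 :=
  a *m a^T - 2^-1 *: (a *m e1v^T) - 2^-1 *: (e1v *m a^T).

Definition symE {R : realType} {k : nat} (a b : 'I_k) : 'M[R]_k :=
  delta_mx a b + delta_mx b a.

Definition Jm {R : realType} {n : nat} (i : 'I_n) : 'M[R]_((5 * n).+1) :=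
  Jmat (delta_mx (bix 5 2 i) ord0).
Definition Mm {R : realType} {n : nat} (i : 'I_n) : 'M[R]_((5 * n).+1) :=
  Jmat (delta_mx (bix 5 3 i) ord0).
Definition Nm {R : realType} {n : nat} (i : 'I_n) : 'M[R]_((3 * n).+1) :=
  Jmat (delta_mx (bix 3 1 i) ord0).

Definition G1 {R : realType} {n N : nat} (xihat : 'I_N -> XiT R n) (j : 'I_N)
  (rho : R) (s : 'I_n -> R) : 'M[R]_((5 * n).+1) :=
  (- (rho / 2)) *: (\sum_(b < 4) \sum_(r < n) symE ord0 (bix 5 b r))
  + \sum_(r < n) ((xmu (xihat j) r - s r) / 2) *: symE ord0 (bix 5 4 r)
  + 2^-1 *: (\sum_(r < n) symE (bix 5 0 r) (bix 5 4 r))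
  - 2^-1 *: (\sum_(r < n) symE (bix 5 1 r) (bix 5 4 r)).

Definition G2 {R : realType} {n N : nat} (xihat : 'I_N -> XiT R n) (j : 'I_N)
  (rho : R) (s : 'I_n -> R) : 'M[R]_((3 * n).+1) :=
  (- rho * (\sum_(i < n) xmu (xihat j) i ^+ 2 + \sum_(i < n) xlam (xihat j) i ^+ 2))
     *: delta_mx ord0 ord0
  + \sum_(r < n) (rho * xmu (xihat j) r) *: symE ord0 (bix 3 0 r)
  + \sum_(r < n) (rho * xlam (xihat j) r) *: symE ord0 (bix 3 1 r)
  - \sum_(r < n) (s r / 2) *: symE ord0 (bix 3 2 r)
  - rho *: (\sum_(r < n) (delta_mx (bix 3 0 r) (bix 3 0 r) + delta_mx (bix 3 1 r) (bix 3 1 r)))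
  + 2^-1 *: (\sum_(r < n) symE (bix 3 0 r) (bix 3 2 r)).

Definition CP1_feas {R : realType} {n N : nat} (Tcap : R) (c d : 'I_n -> R) (C : R)
  (K : nat) (uL uU : 'I_n -> R) (xihat : 'I_N -> XiT R n)
  (rho : R) (beta : 'I_N -> R) (psi phi : 'I_n -> 'I_N -> R) (s : 'I_n -> R) : Prop :=
  (forall j : 'I_N,
     COP (persp (inF1 c d C K uL uU xihat j))
       (beta j *: (e1v *m e1v^T) + \sum_(i < n) psi i j *: Mm i
        + \sum_(i < n) phi i j *: Jm i - G1 xihat j rho s)) /\
  0 <= rho /\ inS Tcap s.

Definition CP1_obj {R : realType} {N : nat} (eps rho : R) (beta : 'I_N -> R) : R :=
  eps * rho + N%:R^-1 * \sum_(j < N) beta j.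

Definition CP1_val {R : realType} {n N : nat} (Tcap : R) (c d : 'I_n -> R) (C : R)
  (K : nat) (uL uU : 'I_n -> R) (xihat : 'I_N -> XiT R n) (eps : R) : \bar R :=
  ereal_inf [set z | exists rho beta psi phi s,
     CP1_feas Tcap c d C K uL uU xihat rho beta psi phi s /\ z = (CP1_obj eps rho beta)%:E].

Definition CP2_feas {R : realType} {n N : nat} (Tcap : R) (c d : 'I_n -> R) (C : R)
  (K : nat) (uL uU : 'I_n -> R) (xihat : 'I_N -> XiT R n)
  (rho : R) (beta : 'I_N -> R) (psi : 'I_n -> 'I_N -> R) (s : 'I_n -> R) : Prop :=
  (forall j : 'I_N,
     COP (persp (inF2 c d C K uL uU))
       (beta j *: (e1v *m e1v^T) + \sum_(i < n) psi i j *: Nm i - G2 xihat j rho s)) /\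
  0 <= rho /\ inS Tcap s.

Definition CP2_obj {R : realType} {N : nat} (eps rho : R) (beta : 'I_N -> R) : R :=
  eps ^+ 2 * rho + N%:R^-1 * \sum_(j < N) beta j.

Definition CP2_val {R : realType} {n N : nat} (Tcap : R) (c d : 'I_n -> R) (C : R)
  (K : nat) (uL uU : 'I_n -> R) (xihat : 'I_N -> XiT R n) (eps : R) : \bar R :=
  ereal_inf [set z | exists rho beta psi s,
     CP2_feas Tcap c d C K uL uU xihat rho beta psi s /\ z = (CP2_obj eps rho beta)%:E].

(* Main.v *)
Require Import Defs.
From HB Require Import structures.
From mathcomp Require Import all_boot all_order all_algebra.
From mathcomp Require Import all_classical all_reals all_analysis.
From mathcomp Require Import measurable_realfun ring lra.
Import Order.TTheory GRing.Theory Num.Theory.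
Import numFieldNormedType.Exports.
Local Open Scope classical_set_scope.
Local Open Scope ring_scope.

Set Implicit Arguments.
Unset Strict Implicit.
Unset Printing Implicit Defensive.

(** For fixed [s], LP duality gives [g(s, xi) = max_(y in Y(lambda)) sum_i (mu_i - s_i) y_i].
    The worst-case expectation has the Lagrangian dual
    [min_(rho >= 0) eps^p rho + 1/N sum_j beta_j], where [beta_j] is the supremum over [Xi]
    of [g(s, xi) - rho |xi - xihat_j|_p^p].  The minimum is attained since [eps > 0]: an optimal
    [rho] separates the slopes of the lines joining the pairs (cost, value) to the point
    (eps^p, worst-case value), which is possible because mixtures of two discrete
    distributions are feasible for the ambiguity set.
    The supremum defining [beta_j] is a nonconvex quadratic program in which only the
    binary constraints [t^2 = t] have been dualized by the copositive program.  This is exact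
    with attained multipliers: every feasible point with fractional [lambda] is within
    distance O(sum_i t_i (1 - t_i)) of one with binary [lambda], so a large multiple of
    [sum_i t_i (1 - t_i)] is an exact penalty. *)

(** * Linear programming duality *)

(** Measurability of [gval] is never established. Upper bounds on its integral test the simple
    functions below its positive part; lower bounds integrate a combination of indicators of atoms
    that lies below it. Sample points may coincide, while a dual potential has to be a function of
    the point and not of the index; averaging over coinciding indices reconciles the two. All
    estimates are made at a fixed [s], with attained [rho] and attained multipliers: this is what
    transfers minimizers and not only the infimum. In the exact penalty, the danger is that
    [sum (1 - lambda_i) <= K] fails after rounding. Since [K] is an integer, the constraint survives
    when the rounding moves by less than 1 in total. Otherwise the penalty sum is at least 1/2 and a
    crude global bound can be charged to it. For p = 1 the parts [lambda^+] and [lambda^-] are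
    rounded separately, and the same threshold keeps the recombined vector binary. The perspective
    cones need no explicit description: a quadratic form is continuous and homogeneous, so only the
    slice t = 1 matters. *)

(* Fourier-Motzkin elimination, one coordinate at a time: [A] only involves the
   first [m] coordinates. *)
Lemma farkas_aux {R : realFieldType} {n : nat} (m : nat) : (m <= n)%N ->
  forall (I : finType) (A : I -> 'I_n -> R) (b : I -> R),
  (forall i (k : 'I_n), (m <= k)%N -> A i k = 0) ->
  (exists x : 'I_n -> R, forall i, \sum_k A i k * x k <= b i) \/
  (exists l : I -> R, (forall i, 0 <= l i) /\
     (forall k, \sum_i l i * A i k = 0) /\ \sum_i l i * b i < 0).
Proof.
elim: m => [|m IHm] mn I A b A0.
  have [[i bi]|/forallNP bi] := pselect (exists i, b i < 0).
    right; exists (fun k => (k == i)%:R); split; first by move=> k; exact: ler0n.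
    have sel (F : I -> R) : \sum_k (k == i)%:R * F k = F i.
      by rewrite (bigD1 i) //= eqxx mul1r big1 ?addr0 // => k /negbTE ->; rewrite mul0r.
    by split=> [k|]; rewrite sel // A0.
  left; exists (fun=> 0) => i; rewrite big1 => [|k _]; last by rewrite mulr0.
  by rewrite leNgt; apply/negP/bi.
pose q : 'I_n := Ordinal mn.
(* Rows free of [q] are kept, and each pair of rows with opposite signs at [q] is combined so that
   [q] cancels. Other indices carry the trivial row 0 <= 0, so the index type stays [I + I * I]. *)
pose A' (t : I + I * I) k : R := match t with
  | inl i => if A i q == 0 then A i k else 0
  | inr (i, j) => if (0 < A i q) && (A j q < 0)
                  then - A j q * A i k + A i q * A j k else 0 end.
pose b' (t : I + I * I) : R := match t with
  | inl i => if A i q == 0 then b i else 0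
  | inr (i, j) => if (0 < A i q) && (A j q < 0)
                  then - A j q * b i + A i q * b j else 0 end.
pose w (t : I + I * I) (h : I) : R := match t with
  | inl i => if A i q == 0 then (h == i)%:R else 0
  | inr (i, j) => if (0 < A i q) && (A j q < 0)
                  then - A j q * (h == i)%:R + A i q * (h == j)%:R else 0 end.
have w_ge0 t h : 0 <= w t h.
  case: t => [i|[i j]] /=; case: ifP => //.
  by case/andP=> i0 j0; rewrite addr_ge0 // mulr_ge0 ?ler0n // ?oppr_ge0 ltW.
have wE (t : I + I * I) (F : I -> R) : \sum_h w t h * F h = match t with
  | inl i => if A i q == 0 then F i else 0
  | inr (i, j) => if (0 < A i q) && (A j q < 0)
                  then - A j q * F i + A i q * F j else 0 end.
  have sel i : \sum_k (k == i)%:R * F k = F i.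
    by rewrite (bigD1 i) //= eqxx mul1r big1 ?addr0 // => k /negbTE ->; rewrite mul0r.
  case: t => [i|[i j]] /=; case: ifP => _; rewrite ?sel //;
    try by rewrite big1 // => h _; rewrite mul0r.
  rewrite -[F i]sel -[F j]sel !mulr_sumr -big_split /=.
  by apply: eq_bigr => h _; rewrite mulrDl !mulrA.
have A'0 t (k : 'I_n) : (m <= k)%N -> A' t k = 0.
  rewrite leq_eqVlt => /orP[/eqP mk|mk].
    have -> : k = q by apply/val_inj.
    case: t => [i|[i j]] /=; case: ifP => //; first by move/eqP.
    by rewrite mulrC mulrN addrC subrr.
  by case: t => [i|[i j]] /=; case: ifP => _ //; rewrite ?(A0 _ _ mk) ?mulr0 ?addr0.
have [[x xP]|[l [l0 [lA lb]]]] := IHm (ltnW mn) _ A' b' A'0; last first.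
  (* A certificate for the reduced system pulls back through [w], which writes every reduced row as
     a nonnegative combination of original rows. *)
  have sw (F : I -> R) (F' : I + I * I -> R) : (forall t, F' t = \sum_h w t h * F h) ->
      \sum_h (\sum_t l t * w t h) * F h = \sum_t l t * F' t.
    move=> F'E; under eq_bigr do rewrite mulr_suml.
    rewrite exchange_big /=; apply: eq_bigr => t _; rewrite F'E mulr_sumr.
    by apply: eq_bigr => h _; rewrite mulrA.
  right; exists (fun h => \sum_t l t * w t h); split.
    by move=> h; apply: sumr_ge0 => t _; exact: mulr_ge0.
  split=> [k|]; first by rewrite (sw _ (A' ^~ k)) ?lA // => t; rewrite wE; case: t => [|[]].
  by rewrite (sw _ b') // => t; rewrite wE; case: t => [|[]].
pose r i := \sum_(k | k != q) A i k * x k.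
have rE i z : \sum_k A i k * (if k == q then z else x k) = A i q * z + r i.
  rewrite (bigD1 q) //= eqxx; congr (_ + _).
  by apply: eq_bigr => k /negbTE ->.
(* The bound that row [i] puts on coordinate [q]: an upper bound when [A i q > 0], a lower one when
   [A i q < 0]. *)
pose u i := (b i - r i) / A i q.
have uP i j : 0 < A i q -> A j q < 0 -> u j <= u i.
  move=> i0 j0; have := xP (inr (i, j)); rewrite /= i0 j0 /=.
  have -> : \sum_k (- A j q * A i k + A i q * A j k) * x k = - A j q * r i + A i q * r j.
    rewrite !mulr_sumr -big_split /= (bigD1 q) //= mulNr (mulrC (A j q)) addNr mul0r add0r.
    by apply: eq_bigr => k _; ring.
  move=> H; rewrite /u -subr_ge0.
  have -> : (b i - r i) / A i q - (b j - r j) / A j q =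
    (- A j q * b i + A i q * b j - (- A j q * r i + A i q * r j)) / (A i q * - A j q).
    by field; rewrite (gt_eqF i0) (lt_eqF j0).
  by apply: divr_ge0; rewrite ?subr_ge0 // mulr_ge0 ?oppr_ge0 // ltW.
have [z [zp zn]] : exists z, (forall i, 0 < A i q -> z <= u i) /\
                            (forall j, A j q < 0 -> u j <= z).
  (* The least upper bound serves as [z]; if there is none, a sum of absolute values exceeds every
     lower bound. *)
  case: (pickP (fun i => 0 < A i q)) => [i0 i0P|nop]; last first.
    exists (\sum_(j | A j q < 0) `|u j|); split=> [i|j j0]; first by rewrite nop.
    rewrite (bigD1 j) //= (le_trans (ler_norm _)) // lerDl.
    by apply: sumr_ge0.
  case: (@arg_minP _ _ _ i0 (fun i => 0 < A i q) u i0P) => i iP imin.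
  by exists (u i); split=> // j /(uP _ _ iP).
left; exists (fun k => if k == q then z else x k) => i; rewrite rE.
case: (ltgtP (A i q) 0) => [i0|i0|i0].
- have := zn i i0; rewrite /u ler_ndivrMr // => H; lra.
- have := zp i i0; rewrite /u ler_pdivlMr // => H; lra.
- have := xP (inl i); rewrite /= i0 eqxx (bigD1 q) //= i0 !mul0r !add0r; exact.
Qed.

Lemma farkas {R : realFieldType} {n : nat} (I : finType) (A : I -> 'I_n -> R) (b : I -> R) :
  (exists x : 'I_n -> R, forall i, \sum_k A i k * x k <= b i) \/
  (exists l : I -> R, (forall i, 0 <= l i) /\
     (forall k, \sum_i l i * A i k = 0) /\ \sum_i l i * b i < 0).
Proof. by apply: (@farkas_aux R n n) => // i k; rewrite leqNgt ltn_ord. Qed.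

(** * Dual of the second-stage problem *)

Definition dual_obj {R : realType} {n : nat} (s : 'I_n -> R) (x : XiT R n)
  (y : 'I_n -> R) : R := \sum_(i < n) (xmu x i - s i) * y i.

Lemma sum_delta {R : pzRingType} {I : finType} (i : I) (F : I -> R) :
  \sum_k (k == i)%:R * F k = F i.
Proof.
by rewrite (bigD1 i) //= eqxx mul1r big1 ?addr0 // => k /negbTE ->; rewrite mul0r.
Qed.

Lemma sum_deltar {R : comPzRingType} {I : finType} (i : I) (F : I -> R) :
  \sum_k F k * (i == k)%:R = F i.
Proof. by rewrite -[RHS]sum_delta; apply: eq_bigr => k _; rewrite mulrC eq_sym. Qed.

Section lp_duality.
Context {R : realType} {n : nat} (c d : 'I_n -> R) (C : R) (s : 'I_n -> R) (x : XiT R n).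
Hypotheses (n0 : (0 < n)%N) (c0 : forall i, 0 <= c i) (d0 : forall i, 0 <= d i) (C0 : 0 <= C).

(** Multiply the i-th flow equation by [y_i] and sum by parts. As [w_1 = 0], the coefficients left
    are [y_(k-1) - y_k] on the inner [w_k], [y_n] on [w_(n+1)] and [- y_i] on [v_i]; the constraints
    of [inY] bound each by the cost of that variable. *)
Lemma g_weak_duality w v y : g_feas s x w v -> inY c d C (xlam x) y ->
  dual_obj s x y <= g_obj c d C x w v.
Proof.
move: c0 d0 C0; clear c0 d0 C0.
case: n n0 c d s x w v y => // m _ c' d' s' x' w v y c0 d0 C0 [wv [w0 [w00 v0]]] [yd [yc yC]].
rewrite /dual_obj /g_obj.
under eq_bigr => i _.
  have -> : (xmu x' i - s' i) * y i =
    w (lift ord0 i) * y i - w (widen_ord (leqnSn m.+1) i) * y i - v i * y i.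
    have wvi := wv i.
    have -> : xmu x' i - s' i = w (lift ord0 i) - v i - w (widen_ord (leqnSn m.+1) i).
      by rewrite wvi; ring.
    by rewrite !mulrBl addrAC.
  over.
rewrite !big_split /= big_ord_recr /= !sumrN [X in _ - X - _]big_ord_recl /=.
rewrite [X in _ <= X + _ + _]big_ord_recl /=.
have e0 : widen_ord (leqnSn m.+1) ord0 = ord0 :> 'I_m.+2 by apply: val_inj.
have eM : lift ord0 ord_max = ord_max :> 'I_m.+2 by apply: val_inj.
rewrite e0 eM w00 mul0r mulr0 !add0r.
have H1 : - \sum_(i < m.+1) v i * y i <= \sum_(i < m.+1) d' i * v i.
  rewrite -sumrN; apply: ler_sum => i _.
  by rewrite -mulrN mulrC ler_wpM2r.
have H2 : w ord_max * y ord_max <= C * w ord_max.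
  by rewrite mulrC ler_wpM2r // yC.
have H3 : \sum_(i < m) w (lift ord0 (widen_ord (leqnSn m) i)) * y (widen_ord (leqnSn m) i) -
  \sum_(i < m) w (widen_ord (leqnSn m.+1) (lift ord0 i)) * y (lift ord0 i) <=
  \sum_(i < m) c' (lift ord0 i) * xlam x' (lift ord0 i) * w (widen_ord (leqnSn m.+1) (lift ord0 i)).
  rewrite -sumrB; apply: ler_sum => i _.
  have -> : lift ord0 (widen_ord (leqnSn m) i) = widen_ord (leqnSn m.+1) (lift ord0 i).
    by apply: val_inj; rewrite /= /bump.
  by rewrite -mulrBr mulrC ler_wpM2r // yc.
lra.
Qed.

(** An alternative at a prescribed level [t] needs no prior attainment on either side: it is Farkas'
    lemma for the constraints of [inY] together with [dual_obj >= t]. *)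
Lemma g_strong_duality t : (forall i, 0 <= xlam x i) ->
  (exists2 y, inY c d C (xlam x) y & t <= dual_obj s x y) \/
  (exists w v, g_feas s x w v /\ g_obj c d C x w v < t).
Proof.
move: c0 d0 C0; clear c0 d0 C0.
case: n n0 c d s x => // m _ c' d' s' x' c0 d0 C0 l0.
pose a k := xmu x' k - s' k.
pose A (t : ('I_m.+1 + 'I_m) + bool) (k : 'I_m.+1) : R := match t with
  | inl (inl i) => - (k == i)%:R
  | inl (inr i) => (k == widen_ord (leqnSn m) i)%:R - (k == lift ord0 i)%:R
  | inr true => (k == ord_max)%:R
  | inr false => - a k end.
pose b (u : ('I_m.+1 + 'I_m) + bool) : R := match u with
  | inl (inl i) => d' i
  | inl (inr i) => c' (lift ord0 i) * xlam x' (lift ord0 i)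
  | inr true => C
  | inr false => - t end.
have [[y yP]|[l [lge0 [lA lb]]]] := farkas A b; [left|right].
  exists y.
    split; [|split].
    - by move=> i; have := yP (inl (inl i)); rewrite /A /b; under eq_bigr do rewrite mulNr;
        rewrite sumrN sum_delta.
    - move=> i k ki; have im : (k < m)%N by rewrite -ltnS ki ltn_ord.
      have := yP (inl (inr (Ordinal im))); rewrite /A /b.
      under eq_bigr do rewrite mulrBl.
      rewrite sumrB !sum_delta.
      have -> : widen_ord (leqnSn m) (Ordinal im) = k by apply: val_inj.
      by have -> : lift ord0 (Ordinal im) = i by apply: val_inj; rewrite /= /bump.
    - move=> i [im]; have := yP (inr true); rewrite /A /b sum_delta.
      by have -> : ord_max = i by apply: val_inj.
  have := yP (inr false); rewrite /A /b /dual_obj.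
  by under eq_bigr do rewrite mulNr; rewrite sumrN lerN2.
pose v k := l (inl (inl k)).
(* The Farkas multipliers are a primal solution up to scaling: [w] is 0 at the first index, the
   multiplier of [y_n <= C] at the last, and those of the chain constraints in between. *)
pose w (k : 'I_m.+2) := if unlift ord0 k is Some k' then
  (if unlift ord_max k' is Some i then l (inl (inr i)) else l (inr true)) else 0.
pose tau := l (inr false).
have w_ge0 k : 0 <= w k by rewrite /w; do 2?case: unlift => *.
have v_ge0 k : 0 <= v k by exact: lge0.
have wM : w ord_max = l (inr true).
  have -> : ord_max = lift ord0 ord_max :> 'I_m.+2 by apply: val_inj.
  by rewrite /w liftK unlift_none.
have ww (i : 'I_m) : w (widen_ord (leqnSn m.+1) (lift ord0 i)) = l (inl (inr i)).
  have -> : widen_ord (leqnSn m.+1) (lift ord0 i) = lift ord0 (lift ord_max i).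
    by apply: val_inj; rewrite /= /bump /= [(m <= i)%N]leqNgt ltn_ord add0n.
  by rewrite /w !liftK.
have w00 : w ord0 = 0 by rewrite /w unlift_none.
have w0 : w (widen_ord (leqnSn m.+1) ord0) = 0.
  by rewrite (_ : widen_ord _ _ = ord0) //; apply: val_inj.
have wl k : \sum_(i < m) l (inl (inr i)) * (k == widen_ord (leqnSn m) i)%:R +
   l (inr true) * (k == ord_max)%:R = w (lift ord0 k).
  have wE (i : 'I_m) : widen_ord (leqnSn m) i = lift ord_max i.
    by apply: val_inj; rewrite /= /bump /= [(m <= i)%N]leqNgt ltn_ord add0n.
  rewrite /w liftK; case: unliftP => [j|] ->.
    rewrite [X in _ + X]mulrC [lift _ _ == _]eq_sym (negbTE (neq_lift _ _)) mul0r addr0.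
    under eq_bigr do rewrite wE (inj_eq lift_inj).
    exact: sum_deltar.
  rewrite eqxx mulr1 big1 ?add0r // => i _.
  by rewrite wE (negbTE (neq_lift _ _)) mulr0.
have wr k : \sum_(i < m) l (inl (inr i)) * (k == lift ord0 i)%:R =
   w (widen_ord (leqnSn m.+1) k).
  case: (unliftP ord0 k) => [j|] ->.
    by under eq_bigr do rewrite (inj_eq lift_inj); rewrite ww sum_deltar.
  by rewrite w0 big1 // => i _; rewrite (negbTE (neq_lift _ _)) mulr0.
have flow k : w (lift ord0 k) - v k = tau * a k + w (widen_ord (leqnSn m.+1) k).
  have := lA k; rewrite !big_sumType /= big_bool /= -wl -wr.
  under eq_bigr do rewrite mulrN.
  rewrite sumrN sum_deltar.
  under eq_bigr do rewrite mulrBr.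
  rewrite sumrB /v /tau. lra.
have obj : \sum_(i < m.+1) (c' i * xlam x' i * w (widen_ord (leqnSn m.+1) i) + d' i * v i)
   + C * w ord_max - tau * t < 0.
  move: lb; rewrite !big_sumType /= big_bool /= -wM.
  rewrite [in X in _ -> X]big_split /= [in X in _ -> X]big_ord_recl /= w0.
  under [in X in _ -> X]eq_bigr do rewrite ww mulrC.
  under [X in _ + _ + X + _ - _]eq_bigr do rewrite mulrC.
  by rewrite /v /tau; lra.
(* With [tau = 0] the negative quantity [obj] would be a sum of nonnegative terms. Dividing by [tau]
   then gives a feasible point of value below [t]. *)
have tau0 : 0 < tau.
  rewrite lt_neqAle lge0 andbT; apply/eqP => tau0; move: obj; rewrite -tau0 mul0r subr0 ltNge.
  rewrite addr_ge0 // ?mulr_ge0 //.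
  by apply: sumr_ge0 => i _; rewrite addr_ge0 // !mulr_ge0.
exists (fun k => w k / tau), (fun k => v k / tau).
have tau1 : 0 <= tau^-1 by rewrite invr_ge0 ltW.
split; [split; [|split; [|split]]|].
- move=> k; have := flow k; rewrite -mulrBl => ->; rewrite mulrDl [tau * _]mulrC mulfK ?gt_eqF //.
  by rewrite /a; ring.
- by move=> k; rewrite mulr_ge0.
- by rewrite w00 mul0r.
- by move=> k; rewrite mulr_ge0.
rewrite /g_obj.
have -> : \sum_(i < m.+1) (c' i * xlam x' i * (w (widen_ord (leqnSn m.+1) i) / tau) + d' i * (v i / tau))
  + C * (w ord_max / tau) =
  (\sum_(i < m.+1) (c' i * xlam x' i * w (widen_ord (leqnSn m.+1) i) + d' i * v i)
   + C * w ord_max) / tau.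
  rewrite mulrDl mulr_suml mulrA; congr (_ + _).
  by apply: eq_bigr => i _; ring.
by rewrite ltr_pdivrMr // -subr_lt0 [t * _]mulrC.
Qed.

End lp_duality.

Lemma g_feasible {R : realType} {n : nat} (s : 'I_n -> R) (x : XiT R n) :
  exists w v, g_feas s x w v.
Proof.
pose p i := Num.max 0 (xmu x i - s i).
exists (fun k => \sum_(i < n | (i < k)%N) p i), (fun i => Num.max 0 (s i - xmu x i)).
split; [move=> i|split; [|split]].
- rewrite (bigD1 i) /=; last by rewrite /bump.
  rewrite (eq_bigl (fun j : 'I_n => (j < i)%N)); last first.
    move=> j; rewrite /bump /= add1n ltnS leq_eqVlt -val_eqE /=.
    by case: (ltngtP j i).
  rewrite /p; case: (ltP (xmu x i) (s i)) => h.
    rewrite max_l ?max_r; lra.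
  rewrite max_r ?max_l; lra.
- by move=> k; apply: sumr_ge0 => i _; rewrite le_max lexx.
- by rewrite big_pred0.
- by move=> i; rewrite le_max lexx.
Qed.

Lemma gval_le {R : realType} {n : nat} (c d : 'I_n -> R) (C : R) (s : 'I_n -> R) (x : XiT R n) w v :
  g_feas s x w v -> (gval c d C s x <= (g_obj c d C x w v)%:E)%E.
Proof. by move=> f; apply: ereal_inf_lbound; exists w, v. Qed.

Section gval_duality.
Context {R : realType} {n : nat} (c d : 'I_n -> R) (C : R) (s : 'I_n -> R) (x : XiT R n).
Hypotheses (n0 : (0 < n)%N) (c0 : forall i, 0 <= c i) (d0 : forall i, 0 <= d i) (C0 : 0 <= C).

Lemma gval_ge_dual y : inY c d C (xlam x) y -> ((dual_obj s x y)%:E <= gval c d C s x)%E.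
Proof.
move=> yY; apply: le_ereal_inf_tmp => _ [w [v [f ->]]].
by rewrite lee_fin g_weak_duality.
Qed.

Hypothesis l0 : forall i, 0 <= xlam x i.

Lemma inY0 : inY c d C (xlam x) (fun=> 0).
Proof.
by split=> [i|]; [rewrite oppr0|split=> [i k _|i _] //; rewrite subrr mulr_ge0].
Qed.

(** The value is finite, between the dual point 0 and some feasible primal point. Taking the value
    itself as level [t], the primal branch of the alternative is contradictory, so the dual branch
    provides a maximizer. *)
Lemma gval_dual : exists2 y, inY c d C (xlam x) y & gval c d C s x = (dual_obj s x y)%:E.
Proof.
have gge0 : (0 <= gval c d C s x)%E.
  by have := gval_ge_dual inY0; rewrite /dual_obj big1 // => i _; rewrite mulr0.
suff [t gt] : exists t, gval c d C s x = t%:E.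
  have [[y yY ty]|[w [v [f lt]]]] := g_strong_duality s n0 c0 d0 C0 t l0.
    exists y => //; apply/eqP; rewrite eq_le gval_ge_dual // andbT.
    by rewrite gt lee_fin.
  by have := gval_le c d C f; rewrite gt lee_fin leNgt lt.
have [w [v f]] := g_feasible s x.
move: gge0 (gval_le c d C f).
by case: (gval c d C s x) => // r _ _; exists r.
Qed.
End gval_duality.

(** * Integration without measurability of the integrand *)

Section mixture.
Context {dsp : measure_display} {T : measurableType dsp} {R : realType}.
Variables (w : nat -> {nonneg R}) (x : nat -> T) (m : nat).
Hypothesis w1 : \sum_(k < m) (w k)%:num = 1.

(** The proof that the weights sum to one is an argument, so that a probability structure can be
    attached to the term. *)
Definition mixture of \sum_(k < m) (w k)%:num = 1 : set T -> \bar R :=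
  msum (fun k => mscale (w k) \d_(x k)) m.

Let mixtureT : mixture w1 setT = 1%E.
Proof.
transitivity (\sum_(k < m) ((w k)%:num)%:E)%E; last by rewrite sumEFin w1.
by apply: eq_bigr => k _; rewrite /= /mscale /= diracT mule1.
Qed.

HB.instance Definition _ := Measure.on (mixture w1).
HB.instance Definition _ := Measure_isProbability.Build _ _ _ (mixture w1) mixtureT.

End mixture.

Lemma finite_mixture {dsp : measure_display} {T : measurableType dsp} {R : realType}
    {I : finType} (w : I -> R) (x : I -> T) :
  (forall i, 0 <= w i) -> \sum_i w i = 1 ->
  exists P : probability T R,
    (forall A, P A = (\sum_i (w i)%:E * \d_(x i) A)%E) /\
    (forall f : T -> \bar R, measurable_fun setT f -> (forall t, (0 <= f t)%E) ->
       (\int[P]_t f t = \sum_i (w i)%:E * f (x i))%E).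
Proof.
move=> w0 w1.
(* Weights of sum one force [I] to be nonempty, which supplies the default element of [nth]. *)
have [i0 _|I0] := pickP (@predT I); last first.
  by move: w1; rewrite big_pred0 // => /eqP; rewrite eq_sym oner_eq0.
pose ix k := nth i0 (enum I) k.
have sumE (F : I -> \bar R) : (\sum_(k < #|I|) F (ix k) = \sum_i F i)%E.
  by rewrite -(big_mkord xpredT (F \o ix)) cardE -(big_nth i0 xpredT F) big_enum.
have w1' : \sum_(k < #|I|) (NngNum (w0 (ix k)))%:num = 1.
  rewrite -w1 -(big_mkord xpredT (w \o ix)) cardE -(big_nth i0 xpredT w) big_enum //.
exists (@mixture _ T R (fun k => NngNum (w0 (ix k))) (fun k => x (ix k)) #|I| w1'); split=> [A|f mf f0]; first by rewrite -sumE.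
rewrite ge0_integral_measure_sum //.
rewrite -sumE; apply: eq_bigr => k _.
by rewrite ge0_integral_mscale // integral_dirac // diracT mul1e.
Qed.

Import HBNNSimple.

(* No measurability of [f] is needed: the integral of [f^\+] is by definition a
   supremum over simple functions. *)
Lemma integral_le_nnsfun {dsp : measure_display} {T : measurableType dsp} {R : realType}
    (mu : {measure set T -> \bar R}) (f : T -> \bar R) (B : \bar R) :
  (forall h : {nnsfun T >-> R}, (forall t, ((h t)%:E <= f^\+ t)%E) ->
     (\int[mu]_t (h t)%:E <= B)%E) ->
  (\int[mu]_t f t <= B)%E.
Proof.
move=> hB; rewrite integralE.
have fn0 : (0 <= \int[mu]_t f^\- t)%E by apply: integral_ge0 => t _; exact: funeneg_ge0.
apply: (@le_trans _ _ (\int[mu]_t f^\+ t)%E); first by rewrite geeDl // leeNl oppe0.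
rewrite ge0_integralTE; last by move=> t; exact: funepos_ge0.
by apply: ge_ereal_sup => _ [h /= hf <-]; rewrite -integralT_nnsfun; exact: hB.
Qed.

(** [f] need not be measurable: a simple function below [f^\-] vanishes off a null set, so the
    negative part integrates to 0, and the integral of [f^\+] is a supremum over more simple
    functions than that of [k]. *)
Lemma integral_ge_ae {dsp : measure_display} {T : measurableType dsp} {R : realType}
    (mu : {measure set T -> \bar R}) (A : set T) (f k : T -> \bar R) :
  measurable A -> mu (~` A) = 0%E -> (forall t, A t -> (0 <= f t)%E) ->
  (forall t, (0 <= k t)%E) -> (forall t, (k t <= f^\+ t)%E) ->
  (\int[mu]_t k t <= \int[mu]_t f t)%E.
Proof.
move=> mA A0 f0 k0 kf; rewrite [leRHS]integralE.
have -> : (\int[mu]_t f^\- t = 0)%E.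
  apply/eqP; rewrite eq_le integral_ge0 ?andbT; last by move=> t _; exact: funeneg_ge0.
  rewrite ge0_integralTE; last by move=> t; exact: funeneg_ge0.
  apply: ge_ereal_sup => _ [h /= hf <-]; rewrite -integralT_nnsfun.
  rewrite -[leRHS](integral0 mu setT).
  apply: ae_ge0_le_integral => //; first by move=> t _; rewrite lee_fin.
  - exact/measurable_EFinP.
  - exists (~` A); split => //; first exact: measurableC.
    move=> t /= H At; apply: H => _.
    have := hf t; suff -> : (f^\- t = 0)%E by [].
    by rewrite funenegE; apply/max_idPr; rewrite leeNl oppe0 f0.
rewrite sube0 [leRHS]ge0_integralTE; last by move=> t; exact: funepos_ge0.
rewrite ge0_integralTE //; apply: ereal_sup_le => _ [h /= hk <-].
by exists h => // t; apply: le_trans (hk t) (kf t).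
Qed.

Lemma integral_coupling1 {dsp : measure_display} {T : measurableType dsp} {R : realType}
    (P : probability (T * T)%type R) (Q : {measure set T -> \bar R}) (f : T -> \bar R) :
  (forall A, measurable A -> P (A `*` setT) = Q A) ->
  measurable_fun setT f -> (forall t, (0 <= f t)%E) ->
  (\int[Q]_t f t = \int[P]_y f y.1)%E.
Proof.
move=> PQ mf f0.
have mfst : measurable_fun setT (@fst T T) by exact: measurable_fst.
rewrite -[RHS](@ge0_integral_pushforward _ _ _ _ _ _ mfst P setT f) //.
apply: eq_measure_integral => A mA _; rewrite -PQ // /pushforward.
by congr (P _); apply/seteqP; split=> y /=; [case|].
Qed.

(** The number of indices at the same location as [j]; dividing by it avoids counting a repeated
    atom several times. *)
Definition multiplicity {R : realType} {I : finType} {T : Type} (z : I -> T) (j : I) : R :=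
  \sum_k \1_[set z j] (z k).

Lemma multiplicity_gt0 {R : realType} {I : finType} {T : Type} (z : I -> T) j :
  0 < multiplicity z j :> R.
Proof.
rewrite /multiplicity (bigD1 j) //= indicE mem_set //.
by apply: ltr_wpDr => //; apply: sumr_ge0 => k _; rewrite indicE ler0n.
Qed.

(** A partition of unity on the atoms, which turns data indexed by [j] into a function of the
    point. *)
Lemma sum_multiplicity {R : realType} {I : finType} {T : Type} (z : I -> T) i :
  \sum_j (multiplicity z j)^-1 * \1_[set z j] (z i) = 1 :> R.
Proof.
have E j : (multiplicity z j)^-1 * \1_[set z j] (z i) =
           (multiplicity z i)^-1 * \1_[set z i] (z j) :> R.
  have [eij|nij] := pselect (z i = z j); first by rewrite /multiplicity eij.
  rewrite !indicE !memNset ?mulr0 //= => e; exact: nij.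
under eq_bigr do rewrite E.
by rewrite -mulr_sumr mulVf // gt_eqF // multiplicity_gt0.
Qed.

(** Integrate [f(x) <= rho cost(x, y) + H(y)] against the coupling, where [H] averages [b] over the
    indices located at [y]. The inequality holds almost everywhere because the first marginal lives
    on [A] and the second on the finitely many atoms. *)
Lemma transport_weak_duality {dsp : measure_display} {T : measurableType dsp} {R : realType}
    {N : nat} (z : 'I_N -> T) (cost : T * T -> R) (P : probability (T * T)%type R)
    (Q : probability T R) (A : set T) (f : T -> \bar R) (rho : R) (b : 'I_N -> R) :
  (0 < N)%N -> (forall j, measurable [set z j]) ->
  measurable_fun setT cost -> (forall y, 0 <= cost y) -> measurable A -> Q A = 1%E ->
  (forall B, measurable B -> P (B `*` setT) = Q B) ->
  (forall B, measurable B -> P (setT `*` B) = (N%:R^-1%:E * \sum_(j < N) \d_(z j) B)%E) ->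
  0 <= rho -> (forall j, 0 <= b j) ->
  (forall t j, A t -> (f t <= (rho * cost (t, z j) + b j)%:E)%E) ->
  (\int[Q]_t f t <= rho%:E * \int[P]_y (cost y)%:E + (N%:R^-1 * \sum_j b j)%:E)%E.
Proof.
move=> N0 mz mcost cost0 mA QA PQ Pz rho0 b0 fb.
have N0' : (N%:R : R) != 0 by rewrite pnatr_eq0 -lt0n.
pose c j : R := multiplicity z j.
have c0 j : 0 < c j by exact: multiplicity_gt0.
pose H (t : T) : R := \sum_j b j / c j * \1_[set z j] t.
have hit v r i : (forall j, z j = z i -> v <= r + b j) -> v <= r + H (z i).
  move=> vb.
  have one : \sum_j (c j)^-1 * \1_[set z j] (z i) = 1 by exact: sum_multiplicity.
  rewrite -[v]mul1r -[r]mul1r -one /H !mulr_suml -big_split /=.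
  apply: ler_sum => j _.
  have -> : (c j)^-1 * \1_[set z j] (z i) * r + b j / c j * \1_[set z j] (z i) =
     (c j)^-1 * \1_[set z j] (z i) * (r + b j) by ring.
  have [eij|nij] := pselect (z j = z i); last first.
    by rewrite indicE memNset ?mulr0 ?mul0r //= => e; exact: nij.
  apply: ler_wpM2l; last exact: vb.
  by rewrite mulr_ge0 ?invr_ge0 ?(ltW (c0 _)) // indicE ler0n.
have mX (B : set T) : measurable B -> measurable ([set: T] `*` B).
  by move=> mB; apply: measurableX => //; exact: measurableT.
have mXl (B : set T) : measurable B -> measurable (B `*` [set: T]).
  by move=> mB; apply: measurableX => //; exact: measurableT.
have iH0 j (y : T * T) : (0 <= (b j / c j * \1_([set: T] `*` [set z j]) y)%:E)%E.
  by rewrite lee_fin !mulr_ge0 ?invr_ge0 ?(ltW (c0 _)) // indicE ler0n.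
have mH j : measurable_fun setT (fun y : T * T => (b j / c j * \1_([set: T] `*` [set z j]) y)%:E).
  apply/measurable_EFinP; apply: measurable_funM => //.
  by apply: measurable_indic; apply: mX.
have mc : measurable_fun setT (fun y : T * T => (rho * cost y)%:E).
  by apply/measurable_EFinP; apply: measurable_funM.
have intK : (\int[P]_y ((rho * cost y)%:E + \sum_j (b j / c j * \1_([set: T] `*` [set z j]) y)%:E)
   = rho%:E * \int[P]_y (cost y)%:E + (N%:R^-1 * \sum_j b j)%:E)%E.
  rewrite ge0_integralD //; last 3 first.
  - by move=> y _; rewrite lee_fin mulr_ge0.
  - by move=> y _; apply: sume_ge0 => j _.
  - by apply: emeasurable_sum => j.
  congr (_ + _)%E.
    under eq_integral do rewrite EFinM.
    rewrite ge0_integralZl //; first exact/measurable_EFinP.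
    by move=> y _; rewrite lee_fin.
  rewrite ge0_integral_sum //.
  rewrite mulr_sumr -sumEFin; apply: eq_bigr => j _.
  under eq_integral do rewrite EFinM.
  rewrite ge0_integralZl //; last 2 first.
  - by apply/measurable_EFinP; apply: measurable_indic; apply: mX.
  - by rewrite lee_fin mulr_ge0 ?invr_ge0 ?(ltW (c0 _)).
  rewrite integral_indic ?setIT //; last exact: mX.
  rewrite [X in (_ * X)%E](_ : _ = N%:R^-1%:E * \sum_(k < N) \d_(z k) [set z j])%E; last exact: Pz.
  have -> : (\sum_(k < N) \d_(z k) [set z j] = (c j)%:E)%E.
    by rewrite /c -sumEFin; apply: eq_bigr => k _; rewrite /dirac.
  by rewrite -!EFinM; congr EFin; field; rewrite N0' gt_eqF.
rewrite -intK.
(* From here on, the measurable simple function [h] replaces [f]. *)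
apply: integral_le_nnsfun => h hf.
rewrite (integral_coupling1 PQ); last 2 first.
- exact/measurable_EFinP.
- by move=> t; rewrite lee_fin.
pose Z : set T := \big[setU/set0]_(j < N) [set z j].
have mZ : measurable Z by apply: bigsetU_measurable.
have ZP t : Z t -> exists j, t = z j.
  by rewrite /Z -bigcup_seq => -[j _ /= ->]; exists j.
have zZ j : Z (z j) by rewrite /Z -bigcup_seq; exists j => //=; rewrite mem_index_enum.
have P1 : P (A `*` setT) = 1%E by rewrite PQ.
have P2 : P (setT `*` Z) = 1%E.
  rewrite Pz //.
  rewrite (eq_bigr (fun=> 1%:E)); last by move=> j _; rewrite diracE mem_set.
  by rewrite sumEFin sumr_const card_ord -EFinM mulVf.
have PC (B : set (T * T)) : measurable B -> P B = 1%E -> P (~` B) = 0%E.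
  by move=> mB PB; apply: etrans (probability_setC P mB) _; rewrite PB subee.
have PC1 := PC _ (mXl _ mA) P1.
have PC2 := PC _ (mX _ mZ) P2.
pose bad := ~` (A `*` [set: T]) `|` ~` ([set: T] `*` Z).
apply: ae_ge0_le_integral => //.
- by move=> y _; rewrite lee_fin.
- by apply/measurable_EFinP; apply: measurableT_comp => //; exact: measurable_fst.
- move=> y _; apply: adde_ge0; first by rewrite lee_fin mulr_ge0.
  by apply: sume_ge0 => j _.
- apply: emeasurable_funD => //.
  by apply: emeasurable_sum => j.
exists bad; split.
- by apply: measurableU; apply: measurableC; [exact: mXl|exact: mX].
- apply/eqP; rewrite eq_le measure_ge0 andbT.
  apply: le_trans (measureU2 _ _ _) _; [by apply: measurableC; exact: mXl|by apply: measurableC; exact: mX|].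
  have le0 (v : \bar R) : v = 0%E -> (v <= 0)%E by move=> ->.
  rewrite -[leRHS]adde0; by apply: leeD; apply: le0.
move=> y /=; apply: contra_notP => /not_orP[/contrapT [Ay _] /contrapT [_ /ZP[i yi]]] _.
apply: le_trans (hf y.1) _.
have y2E : (\sum_j (b j / c j * \1_([set: T] `*` [set z j]) y)%:E = (H y.2)%:E)%E.
  rewrite sumEFin; congr EFin; apply: eq_bigr => j _; congr (_ * _).
  by rewrite !indicE; congr (nat_of_bool _)%:R; apply/idP/idP => /set_mem u; apply/mem_set; [case: u|split].
rewrite y2E -EFinD.
(* The positive part is the maximum of [f] and 0; nonnegativity of [rho], the cost and [b] covers
   the 0. *)
have fv : forall j, (f^\+ y.1 <= (rho * cost (y.1, z j) + b j)%:E)%E.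
  move=> j; rewrite funeposE ge_max fb //= lee_fin addr_ge0 // mulr_ge0 //.
move: (funepos_ge0 f y.1) fv; case: (f^\+ y.1)%E => [v| |] // _ fv.
  rewrite lee_fin [in H _]yi; apply: hit => j zji.
  by have := fv j; rewrite lee_fin zji -yi -surjective_pairing.
by have := fv i.
Qed.

(** * Measurability *)

Section measurability.
Context {R : realType} {n : nat}.

Lemma measurable_xmu i : measurable_fun setT (fun x : XiT R n => xmu x i).
Proof. exact: (measurableT_comp (measurable_tnth i) measurable_fst). Qed.

Lemma measurable_xlam i : measurable_fun setT (fun x : XiT R n => xlam x i).
Proof. exact: (measurableT_comp (measurable_tnth i) measurable_snd). Qed.

Lemma measurable_costp p :
  measurable_fun setT (fun y : XiT R n * XiT R n => costp p y.1 y.2).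
Proof.
have mc (f : XiT R n -> R) : measurable_fun setT f ->
    measurable_fun setT (fun y : XiT R n * XiT R n => `|f y.1 - f y.2| ^+ p).
  move=> mf; apply: measurable_funX; apply: measurableT_comp => //.
  by apply: measurable_funB; apply: measurableT_comp.
apply: measurable_funD; apply: measurable_sum => i.
  exact: (mc _ (measurable_xmu i)).
exact: (mc _ (measurable_xlam i)).
Qed.

Lemma costp_ge0 p (x y : XiT R n) : 0 <= costp p x y.
Proof. by apply: addr_ge0; apply: sumr_ge0 => i _; rewrite exprn_ge0. Qed.

Lemma costpxx p (x : XiT R n) : (0 < p)%N -> costp p x x = 0.
Proof.
by move=> p0; rewrite /costp !big1 ?addr0 // => i _; rewrite subrr normr0 expr0n gtn_eqF.
Qed.

Lemma costp1_eq0 (x y : XiT R n) : costp 1 x y = 0 -> x = y.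
Proof.
move=> /eqP; rewrite paddr_eq0; try by apply: sumr_ge0.
case/andP=> /eqP h1 /eqP h2.
case: x y h1 h2 => [a b] [a' b'] h1 h2; congr pair; apply: eq_from_tnth => i;
  apply/eqP; rewrite -subr_eq0 -normr_eq0 -[X in X == _]expr1; apply/eqP.
- by have /= := @psumr_eq0P _ _ _ _ (fun i _ => normr_ge0 _) h1 i isT.
- by have /= := @psumr_eq0P _ _ _ _ (fun i _ => normr_ge0 _) h2 i isT.
Qed.

(** A singleton is the zero set of the l1-distance to its point, which is measurable. *)
Lemma measurable_XiT1 (x : XiT R n) : measurable [set x].
Proof.
have mf : measurable_fun setT (fun y => costp 1 y x).
  exact: (measurable_fun_pair1 x (measurable_costp 1)).
rewrite (_ : [set x] = setT `&` (fun y => costp 1 y x) @^-1` [set 0]); first exact: mf.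
apply/seteqP; split=> y /=; first by move=> ->; rewrite costpxx.
by case=> _ /costp1_eq0.
Qed.

Lemma measurable_le_set {dsp : measure_display} {T : measurableType dsp} (f g : T -> R) :
  measurable_fun setT f -> measurable_fun setT g -> measurable [set x | f x <= g x].
Proof.
move=> mf mg.
have -> : [set x | f x <= g x] = setT `&` (fun x => g x - f x) @^-1` `[0, +oo[%classic.
  by apply/seteqP; split=> x /=; rewrite in_itv /= andbT subr_ge0 //; case.
exact: measurable_funB.
Qed.

Lemma measurable_forall_set {dsp : measure_display} {T : measurableType dsp} {I : finType}
    (P : I -> T -> Prop) :
  (forall i, measurable [set x | P i x]) -> measurable [set x | forall i, P i x].
Proof.
move=> mP; have -> : [set x | forall i, P i x] = \bigcap_(i in [set: I]) [set x | P i x].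
  by apply/seteqP; split=> x /= Px; [move=> i _; exact: Px|move=> i; exact: (Px i)].
by apply: fin_bigcap_measurable.
Qed.

Lemma measurable_inXi K (uL uU : 'I_n -> R) : measurable [set x | inXi K uL uU x].
Proof.
have ml := @measurable_xlam; have mm := @measurable_xmu.
have mc i a : measurable [set x : XiT R n | xlam x i = a].
  rewrite (_ : [set x | _] = setT `&` (fun x => xlam x i) @^-1` [set a]); first exact: ml.
  by apply/seteqP; split=> x /=; [|case].
apply: measurableI; [apply: measurableI|].
- apply: measurable_forall_set => i.
  by apply: measurableU; exact: mc.
- apply: measurable_le_set => //; apply: measurable_sum => i.
  by apply: measurable_funB => //; exact: ml.
- apply: measurable_forall_set => i; apply: measurableI.
    by apply: measurable_le_set => //; apply: measurable_funM => //; exact: ml.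
  by apply: measurable_le_set => //; apply: measurable_funM => //; exact: ml.
Qed.

End measurability.

(** * Wasserstein duality *)

Section wasserstein.
Context {R : realType} {n N : nat} (K : nat) (uL uU : 'I_n -> R) (xihat : 'I_N -> XiT R n).
Context (c d : 'I_n -> R) (C : R) (p : nat) (eps : R).
Hypotheses (N0 : (0 < N)%N) (p0 : (0 < p)%N) (eps0 : 0 < eps).

Let pR0 : (p%:R : R) != 0. Proof. by rewrite pnatr_eq0 -lt0n. Qed.

Lemma poweR_invn_le (I : \bar R) : (0 <= I)%E ->
  (poweR I p%:R^-1 <= eps%:E)%E = (I <= (eps ^+ p)%:E)%E.
Proof.
move=> I0; have pV0 : (0 <= p%:R^-1 :> R) by rewrite invr_ge0 ler0n.
have epsE : poweR (eps ^+ p)%:E p%:R^-1 = eps%:E.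
  rewrite poweR_EFin; congr EFin.
  by rewrite -powR_mulrn ?(ltW eps0) // -powRrM mulfV // powRr1 // ltW.
have itvP (x : \bar R) : (0 <= x)%E -> x \in `[0%E, +oo%E] by move=> x0; rewrite in_itv /= x0 leey.
have eps0' : (0 <= eps%:E)%E by rewrite lee_fin ltW.
apply/idP/idP => h.
  have := gt0_ler_poweR (ler0n R p) (itvP _ (poweR_ge0 _ _)) (itvP _ eps0') h.
  by rewrite -poweRrM mulVf // poweRe1 // poweR_EFin powR_mulrn // ltW.
rewrite -epsE; apply: (gt0_ler_poweR pV0 (itvP _ _) (itvP _ _) h) => //.
by rewrite lee_fin exprn_ge0 // ltW.
Qed.

Lemma transport_cost_ge0 (Q1 Q2 : set (XiT R n) -> \bar R) :
  (0 <= ereal_inf [set z | exists P : probability (XiT R n * XiT R n)%type R,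
            coupling P Q1 Q2 /\ z = (\int[P]_y (costp p y.1 y.2)%:E)%E])%E.
Proof.
apply: le_ereal_inf_tmp => _ [P [_ ->]].
by apply: integral_ge0 => y _; rewrite lee_fin costp_ge0.
Qed.

Lemma worst_le (s : 'I_n -> R) (rho : R) (b : 'I_N -> R) :
  0 <= rho -> (forall j, 0 <= b j) ->
  (forall x j, inXi K uL uU x ->
     (gval c d C s x <= (rho * costp p x (xihat j) + b j)%:E)%E) ->
  (worst c d C K uL uU xihat p eps s <= (eps ^+ p * rho + N%:R^-1 * \sum_j b j)%:E)%E.
Proof.
move=> rho0 b0 gb; apply: ge_ereal_sup => _ [Q [[QXi Qd] ->]].
move: Qd; rewrite /wdist poweR_invn_le ?transport_cost_ge0 // => Qd.
have key (P : probability (XiT R n * XiT R n)%type R) : coupling P Q (empirical xihat) ->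
    (\int[Q]_x gval c d C s x <=
     rho%:E * \int[P]_y (costp p y.1 y.2)%:E + (N%:R^-1 * \sum_j b j)%:E)%E.
  move=> cP; apply: (@transport_weak_duality _ _ _ _ xihat (fun y => costp p y.1 y.2) P Q
    [set x | inXi K uL uU x]) => //.
  - by move=> j; exact: measurable_XiT1.
  - exact: measurable_costp.
  - by move=> y; exact: costp_ge0.
  - exact: measurable_inXi.
  - by move=> A mA; case: (cP A mA).
  - by move=> A mA; case: (cP A mA).
apply: (introT (lee_addgt0Pr _ _)) => e e0.
(* The infimum over couplings may not be attained, so a slack is spent. Since
   [rho / (rho + 1) <= 1], it costs at most [e], and the [+ 1] allows [rho = 0]. *)
have : (ereal_inf [set z | exists P : probability (XiT R n * XiT R n)%type R,
    coupling P Q (empirical xihat) /\ z = (\int[P]_y (costp p y.1 y.2)%:E)%E] <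
    (eps ^+ p + e / (rho + 1))%:E)%E.
  apply: le_lt_trans Qd _; rewrite lte_fin ltrDl divr_gt0 //.
  by rewrite ltr_wpDl.
case/ereal_inf_lt => _ [P [cP ->]] Plt.
apply: le_trans (key P cP) _.
apply: (@le_trans _ _ (rho%:E * (eps ^+ p + e / (rho + 1))%:E + (N%:R^-1 * \sum_j b j)%:E)%E).
  by apply: leeD => //; apply: lee_wpmul2l; [rewrite lee_fin|exact: ltW].
rewrite -!EFinM -!EFinD lee_fin.
have : rho * (e / (rho + 1)) <= e.
  rewrite mulrA ler_pdivrMr ?ltr_wpDl // mulrC.
  by apply: ler_wpM2l; [exact: ltW|rewrite lerDl].
lra.
Qed.

(** Split the mass 1/N at [xihat j] between [x true j] and [x false j] in proportions [th].
    Recording the sample index of each atom gives the coupling; its second marginal is the empirical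
    measure because [th] sums to 1. *)
Lemma worst_ge (s : 'I_n -> R) (th : bool -> R) (x : bool -> 'I_N -> XiT R n)
    (v : bool -> 'I_N -> R) :
  (forall z, inXi K uL uU z -> (0 <= gval c d C s z)%E) ->
  (forall a, 0 <= th a) -> th true + th false = 1 ->
  (forall a j, inXi K uL uU (x a j)) ->
  (forall a j, gval c d C s (x a j) = (v a j)%:E) ->
  \sum_a th a * (N%:R^-1 * \sum_j costp p (x a j) (xihat j)) <= eps ^+ p ->
  ((\sum_a th a * (N%:R^-1 * \sum_j v a j))%:E <= worst c d C K uL uU xihat p eps s)%E.
Proof.
move=> g0 th0 th1 xXi xv xcost.
have N0' : (N%:R : R) != 0 by rewrite pnatr_eq0 -lt0n.
pose w (i : bool * 'I_N) : R := th i.1 / N%:R.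
pose z (i : bool * 'I_N) := x i.1 i.2.
have wsum (F : bool -> 'I_N -> R) :
    \sum_i w i * F i.1 i.2 = \sum_a th a * (N%:R^-1 * \sum_j F a j).
  rewrite -(pair_bigA _ (fun a j => w (a, j) * F a j)) /=; apply: eq_bigr => a _.
  by rewrite !mulr_sumr; apply: eq_bigr => j _; rewrite /w mulrA.
have w0 i : 0 <= w i by rewrite /w divr_ge0.
have w1 : \sum_i w i = 1.
  have := wsum (fun _ _ => 1); under eq_bigr do rewrite mulr1.
  move=> ->; under eq_bigr do rewrite sumr_const card_ord mulVf // mulr1.
  by rewrite big_bool.
have [Q [QA Qint]] := finite_mixture z w0 w1.
have [P [PA Pint]] := finite_mixture (fun i => (z i, xihat i.2)) w0 w1.
have Qball : inBall K uL uU xihat p eps Q.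
  split.
    rewrite QA; under eq_bigr => i _.
      rewrite diracE mem_set ?mule1; last exact: xXi.
      over.
    by rewrite sumEFin w1.
  rewrite /wdist poweR_invn_le ?transport_cost_ge0 //.
  apply: ge_ereal_inf; exists (\int[P]_y (costp p y.1 y.2)%:E)%E.
    exists P; split=> // A mA; rewrite !PA QA; split.
      apply: eq_bigr => i _; congr (_ * _)%E; rewrite !diracE; congr (_%:R%:E).
      by congr nat_of_bool; apply/idP/idP => /set_mem u; apply/mem_set; [case: u|split].
    transitivity (\sum_(i : bool * 'I_N) (w i * \1_A (xihat i.2))%:E)%E.
      apply: eq_bigr => i _; rewrite [RHS]EFinM; congr (_ * _)%E; rewrite diracE indicE; congr (_%:R%:E).
      by congr nat_of_bool; apply/idP/idP => /set_mem u; apply/mem_set; [case: u|split].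
    rewrite sumEFin (wsum (fun _ j => \1_A (xihat j))) -mulr_suml big_bool /= th1 mul1r.
    by rewrite EFinM -sumEFin.
  rewrite Pint.
  - under eq_bigr do rewrite -EFinM.
    by rewrite sumEFin lee_fin (wsum (fun a j => costp p (x a j) (xihat j))).
  - by apply/measurable_EFinP; exact: measurable_costp.
  - by move=> y; rewrite lee_fin costp_ge0.
apply: le_ereal_sup_tmp; exists (\int[Q]_x gval c d C s x)%E; first by exists Q.
have v0 a j : 0 <= v a j by rewrite -lee_fin -xv g0.
(* A measurable minorant of the value function: it agrees with it at the atoms and vanishes
   elsewhere. *)
pose k t : R := \sum_i v i.1 i.2 / multiplicity z i * \1_[set z i] t.
have kz i : k (z i) = v i.1 i.2.
  transitivity (v i.1 i.2 * \sum_j (multiplicity z j)^-1 * \1_[set z j] (z i)); last first.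
    by rewrite sum_multiplicity mulr1.
  rewrite mulr_sumr; apply: eq_bigr => j _.
  have [eij|nij] := pselect (z j = z i); last first.
    by rewrite indicE memNset ?mulr0 ?mulr0 // => e; exact: nij.
  rewrite mulrA; congr (_ / _ * _).
  by apply: EFin_inj; rewrite -!xv -/(z _) -/(z j) eij.
have k0 t : 0 <= k t.
  by apply: sumr_ge0 => i _; rewrite !mulr_ge0 ?invr_ge0 ?(ltW (multiplicity_gt0 _ _)).
have mk : measurable_fun setT (fun t => (k t)%:E).
  apply/measurable_EFinP; apply: measurable_sum => i; apply: measurable_funM => //.
  by apply: measurable_indic; exact: measurable_XiT1.
apply: (@le_trans _ _ (\int[Q]_t (k t)%:E)%E).
  rewrite Qint //.
  rewrite (eq_bigr (fun i => (w i * v i.1 i.2)%:E)); last by move=> i _; rewrite kz -EFinM.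
  by rewrite sumEFin wsum.
apply: (@integral_ge_ae _ _ _ Q [set t | inXi K uL uU t]) => //.
- exact: measurable_inXi.
- by apply: etrans (probability_setC Q (measurable_inXi _ _ _)) _; rewrite Qball.1 subee.
move=> t; have [[i ->]|nt] := pselect (exists i, t = z i).
  by rewrite kz funeposE le_max xv lexx.
rewrite (_ : k t = 0) ?funepos_ge0 // /k big1 // => i _.
by rewrite indicE memNset ?mulr0 // => e; apply: nt; exists i.
Qed.

End wasserstein.

(** One-dimensional separation in which [P] itself is not convex: only two-point mixtures are
    tested. The pair [(0, V0)] is a Slater point, since [0 < e], and bounds the slopes from
    above. *)
Lemma exists_multiplier {R : realType} (P : R -> R -> Prop) (e m V0 : R) :
  0 < e -> P 0 V0 ->
  (forall t D1 V1 D2 V2, 0 <= t <= 1 -> P D1 V1 -> P D2 V2 ->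
     t * D1 + (1 - t) * D2 <= e -> t * V1 + (1 - t) * V2 <= m) ->
  exists2 rho, 0 <= rho & forall D V, P D V -> V + rho * (e - D) <= m.
Proof.
move=> e0 P0 mix.
(* Slopes from [(e, m)] to the pairs of cost above [e]; including 0 makes the supremum
   nonnegative. *)
pose E := [set r : R | r = 0 \/ exists D V, [/\ P D V, e < D & r = (V - m) / (D - e)]].
have Eub D2 V2 : P D2 V2 -> D2 < e -> ubound E ((m - V2) / (e - D2)).
  move=> P2 D2e _ [->|[D1 [V1 [P1 D1e ->]]]].
    apply: divr_ge0; last by rewrite subr_ge0 ltW.
    have := mix 0 _ _ _ _ _ P2 P2; rewrite lexx ler01 !mul0r !add0r subr0 !mul1r subr_ge0.
    by apply=> //; exact: ltW.
  rewrite ler_pdivrMr ?subr_gt0 // mulrAC ler_pdivlMr ?subr_gt0 //.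
  have w0 : 0 < D1 - D2 by lra.
  (* This weight brings the mixed cost to exactly [e]. *)
  have := mix ((e - D2) / (D1 - D2)) _ _ _ _ _ P1 P2.
  have -> : 1 - (e - D2) / (D1 - D2) = (D1 - e) / (D1 - D2) by field; rewrite gt_eqF.
  rewrite divr_ge0 ?ler_pdivrMr //=; [|lra|lra].
  move=> H; have {}H := H ltac:(lra).
  have E1 a b : (e - D2) / (D1 - D2) * a + (D1 - e) / (D1 - D2) * b =
     ((e - D2) * a + (D1 - e) * b) / (D1 - D2) by field; rewrite gt_eqF.
  move: H; rewrite !E1 !ler_pdivrMr //.
  move=> H; have {}H := H ltac:(lra); lra.
have E0 : E 0 by left.
have Es : has_sup E.
  by split; [exists 0|exists ((m - V0) / (e - 0)); apply: Eub].
exists (sup E); first exact: (sup_upper_bound Es).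
move=> D V PDV; case: (ltgtP D e) => De.
- have : sup E <= (m - V) / (e - D) by apply: ge_sup; [exists 0|exact: Eub].
  rewrite ler_pdivlMr ?subr_gt0 // => ?; lra.
- have : (V - m) / (D - e) <= sup E.
    by apply: (sup_upper_bound Es); right; exists D, V.
  rewrite ler_pdivrMr ?subr_gt0 // => ?; lra.
- rewrite De subrr mulr0 addr0.
  have := mix 1 _ _ _ _ _ PDV PDV; rewrite lexx ler01 subrr !mul0r !addr0 !mul1r De lexx.
  exact.
Qed.

(** The coordinates are chosen independently, so the supremum of the sum is the sum of the
    suprema. *)
Lemma separable_bound {R : realType} {N : nat} {X : Type} (A : X -> Prop) (F : 'I_N -> X -> R)
    (M : R) (x0 : X) :
  A x0 -> (forall x : 'I_N -> X, (forall j, A (x j)) -> \sum_j F j (x j) <= M) ->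
  exists2 b : 'I_N -> R, (forall j x, A x -> F j x <= b j) & \sum_j b j <= M.
Proof.
move=> A0 FM.
pose E j := [set r : R | exists2 x, A x & r = F j x].
have Es j : has_sup (E j).
  split; first by exists (F j x0), x0.
  (* Freezing the other coordinates at [x0] bounds [F j] alone. *)
  exists (M - \sum_(k | k != j) F k x0) => _ [x Ax ->].
  have := FM (fun k => if k == j then x else x0).
  rewrite (bigD1 j) //= eqxx.
  under eq_bigr => k /negbTE kj do rewrite kj.
  rewrite lerBrDr; apply => k; by case: ifP.
exists (fun j => sup (E j)).
  by move=> j x Ax; apply: (sup_upper_bound (Es j)); exists x.
apply/ler_addgt0Pr => e e0.
have e1 : 0 < e / (N%:R + 1) by rewrite divr_gt0 // ltr_wpDl.
have /choice[x xP] : forall j, exists x, A x /\ sup (E j) - e / (N%:R + 1) < F j x.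
  by move=> j; have [_ [x Ax ->] lt] := sup_adherent e1 (Es j); exists x.
have : \sum_j sup (E j) <= \sum_j (F j (x j) + e / (N%:R + 1)).
  by apply: ler_sum => j _; have [_] := xP j; rewrite ltrBlDr => /ltW.
rewrite big_split /= sumr_const card_ord -[_ *+ N]mulr_natl => H.
have := FM x (fun j => (xP j).1).
have : N%:R * (e / (N%:R + 1)) <= e.
  rewrite mulrA ler_pdivrMr ?ltr_wpDl // mulrC.
  by apply: ler_wpM2l; [exact: ltW|rewrite lerDl].
lra.
Qed.

Section wasserstein_duality.
Context {R : realType} {n N : nat} (K : nat) (uL uU : 'I_n -> R) (xihat : 'I_N -> XiT R n).
Context (c d : 'I_n -> R) (C : R) (p : nat) (eps : R) (s : 'I_n -> R) (B : R).
Hypotheses (N0 : (0 < N)%N) (p0 : (0 < p)%N) (eps0 : 0 < eps).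
Hypothesis xihatXi : forall j, inXi K uL uU (xihat j).
Hypothesis gB : forall x, inXi K uL uU x -> (0 <= gval c d C s x <= B%:E)%E.

(** The bound [B] makes the worst case a real number [m]. The multiplier inequality concerns a joint
    choice of one destination per sample point; being a sum over [j], it splits into one bound [b j]
    per point. *)
Lemma worst_dual_attained : exists rho (b : 'I_N -> R), [/\ 0 <= rho,
  (forall x j, inXi K uL uU x -> (gval c d C s x <= (rho * costp p x (xihat j) + b j)%:E)%E) &
  ((eps ^+ p * rho + N%:R^-1 * \sum_j b j)%:E <= worst c d C K uL uU xihat p eps s)%E].
Proof.
have N0' : 0 < N%:R :> R by rewrite ltr0n.
pose g x := fine (gval c d C s x).
have gE x : inXi K uL uU x -> gval c d C s x = (g x)%:E.
  by move=> /gB /andP[]; rewrite /g; case: (gval c d C s x).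
have ge0 x : inXi K uL uU x -> (0 <= gval c d C s x)%E by move=> /gB /andP[].
have B0 : 0 <= B.
  by have := gB (xihatXi (Ordinal N0)) => /andP[/le_trans h /h]; rewrite lee_fin.
have low th (x : bool -> 'I_N -> XiT R n) := @worst_ge R n N K uL uU xihat c d C p eps N0 p0 eps0 s
  th x (fun a j => g (x a j)) ge0.
have up : (worst c d C K uL uU xihat p eps s <= (eps ^+ p * 0 + N%:R^-1 * \sum_(j < N) B)%:E)%E.
  apply: worst_le => // x j xXi; rewrite mul0r add0r.
  by have /andP[] := gB xXi.
have [m mE] : exists m, worst c d C K uL uU xihat p eps s = m%:E.
  have : (0 <= worst c d C K uL uU xihat p eps s)%E.
    apply: le_trans (low (fun a => a%:R) (fun _ => xihat) _ _ _ _ _).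
    - rewrite lee_fin; apply: sumr_ge0 => a _; rewrite !mulr_ge0 ?invr_ge0 ?ler0n //.
      by apply: sumr_ge0 => j _; rewrite -lee_fin -gE // ge0.
    - by move=> a; rewrite ler0n.
    - by rewrite addr0.
    - by [].
    - by move=> a j; rewrite gE.
    - rewrite big1 ?exprn_ge0 ?(ltW eps0) // => a _.
      by rewrite big1 ?mulr0 // => j _; rewrite costpxx.
  by move: up; case: (worst _ _ _ _ _ _ _ _ _ _) => // r _ _; exists r.
rewrite mE.
pose P D V := exists2 x : 'I_N -> XiT R n, (forall j, inXi K uL uU (x j)) &
  D = N%:R^-1 * \sum_j costp p (x j) (xihat j) /\ V = N%:R^-1 * \sum_j g (x j).
have [|||rho rho0 rhoP] := @exists_multiplier R P (eps ^+ p) m (N%:R^-1 * \sum_j g (xihat j)).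
- by rewrite exprn_gt0.
- exists xihat => //; split => //.
  by rewrite big1 ?mulr0 // => j _; rewrite costpxx.
- move=> t _ _ _ _ /andP[t0 t1] [x1 x1Xi [-> ->]] [x2 x2Xi [-> ->]] le.
  have := low (fun a => if a then t else 1 - t) (fun a => if a then x1 else x2).
  rewrite mE lee_fin !big_bool /=; apply => //.
  - by case=> //; rewrite subr_ge0.
  - by rewrite addrC subrK.
  - by case.
  - by case=> j; rewrite gE.
have [x xXi|b bP bM] := @separable_bound R N _ (inXi K uL uU)
    (fun j x => g x - rho * costp p x (xihat j)) (N%:R * (m - rho * eps ^+ p))
    (xihat (Ordinal N0)) (xihatXi _).
  have := rhoP _ _ (ex_intro2 _ _ x xXi (conj erefl erefl)).
  rewrite sumrB -mulr_sumr -ler_pdivrMl // => H.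
  by rewrite mulrBr [in X in _ - X]mulrCA; lra.
exists rho, b; split => //.
  move=> x j xXi; rewrite gE // lee_fin.
  by have := bP j x xXi; lra.
rewrite lee_fin; move: bM; rewrite -ler_pdivrMl //; lra.
Qed.

End wasserstein_duality.

(** * Exact penalty *)

Section dual_polytope.
Context {R : realType} {n : nat} (c d : 'I_n -> R) (C : R).
Hypotheses (c0 : forall i, 0 <= c i) (d0 : forall i, 0 <= d i) (C0 : 0 <= C).
Implicit Types (la y f : 'I_n -> R).

Let tail f (i : 'I_n) := \sum_(k < n | (i < k)%N) f k.
Let head f (i : 'I_n) := \sum_(k < n | (k <= i)%N) f k.

Let tailS f (i k : 'I_n) : i.+1 = k :> nat -> tail f i = f k + tail f k.
Proof.
move=> ik; rewrite /tail (bigD1 k) /=; last by rewrite -ik.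
congr (_ + _); apply: eq_bigl => j; rewrite -val_eqE /= -ik.
by case: (ltngtP i.+1 j) => // /ltnW.
Qed.

Let headS f (i k : 'I_n) : i.+1 = k :> nat -> head f k = head f i + f k.
Proof.
move=> ik; rewrite /head (bigD1 k) //= addrC; congr (_ + _).
by apply: eq_bigl => j; rewrite -val_eqE /= -ik [RHS]leqNgt; case: (ltngtP j i.+1).
Qed.

Let tail_last f (i : 'I_n) : i.+1 = n -> tail f i = 0.
Proof. by move=> iN; rewrite /tail big_pred0 // => j; rewrite ltnNge -ltnS iN ltn_ord. Qed.

Let tail_ge0 f i : (forall k, 0 <= f k) -> 0 <= tail f i.
Proof. by move=> f0; apply: sumr_ge0. Qed.

Let partial_le f (P : pred 'I_n) : (forall k, 0 <= f k) -> \sum_(k | P k) f k <= \sum_k f k.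
Proof.
by move=> f0; rewrite [leRHS](bigID P) /= lerDl; apply: sumr_ge0.
Qed.

(** Telescope the chain constraints from [i] up to the last coordinate, which is at most [C]. *)
Lemma inY_le_tail la y : inY c d C la y ->
  forall i, y i <= C + \sum_(k < n | (i < k)%N) c k * la k.
Proof.
move=> [_ [yc yC]] i; rewrite -/(tail (fun k => c k * la k) i).
have [m] := ubnP (n - i); elim: m i => // m IH i im.
have := ltn_ord i; rewrite leq_eqVlt => /orP[/eqP iN|iN].
  by rewrite tail_last // addr0 yC.
have ik : i.+1 = Ordinal iN :> nat by [].
rewrite (tailS _ ik).
have := yc (Ordinal iN) i ik.
have : y (Ordinal iN) <= C + tail (fun k => c k * la k) (Ordinal iN).
  apply: IH => /=; move: im; rewrite !ltnS.
  by apply: leq_trans; rewrite ltn_sub2l // ltnS.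
lra.
Qed.

Lemma inY_bounded la y : (forall i, 0 <= la i <= 1) -> inY c d C la y ->
  forall i, `|y i| <= C + \sum_k c k + \sum_k d k.
Proof.
move=> la01 yY i; rewrite ler_norml.
have h1 := inY_le_tail yY i.
have h2 : \sum_(k < n | (i < k)%N) c k * la k <= \sum_k c k.
  apply: le_trans (partial_le _ _) _.
    by move=> k; rewrite mulr_ge0 //; case/andP: (la01 k).
  by apply: ler_sum => k _; apply: ler_piMr => //; case/andP: (la01 k).
have h3 : - y i <= d i by exact: yY.1.
have h7 : 0 <= C by [].
have h4 : d i <= \sum_k d k.
  by rewrite (bigD1 i) //= lerDl; apply: sumr_ge0.
have h5 : 0 <= \sum_k d k by apply: sumr_ge0.
have h6 : 0 <= \sum_k c k by apply: sumr_ge0.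
by apply/andP; split; lra.
Qed.

(* Raise [y] progressively along the chain, capped by the largest admissible value
   for the new [la']. *)
Lemma inY_perturb la la' y : (forall i, 0 <= la' i) -> inY c d C la y ->
  exists2 y', inY c d C la' y' &
    forall i, `|y i - y' i| <= \sum_k c k * `|la k - la' k|.
Proof.
move=> la'0 yY; have [yd [yc yC]] := yY.
pose e k := c k * `|la k - la' k|.
pose f k := c k * la' k.
have e0 k : 0 <= e k by rewrite mulr_ge0.
have f0 k : 0 <= f k by rewrite mulr_ge0.
have ef k : c k * la k <= f k + e k.
  rewrite /f /e -mulrDr ler_wpM2l //.
  have := ler_norm (la k - la' k); lra.
(* Adding [head e] lowers each difference [y_(i-1) - y_i] by [e i], enough to pass from [la] to
   [la']. The cap [C + tail f] meets the new chain constraints with equality and restores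
   [y_n <= C]. Difference constraints are stable under minimum. *)
exists (fun i => Num.min (y i + head e i) (C + tail f i)); last first.
  move=> i /=; rewrite -[X in _ <= X]/(\sum_k e k) ler_norml.
  have h1 : head e i <= \sum_k e k by exact: partial_le.
  have h1' : 0 <= head e i by apply: sumr_ge0.
  have h2 : y i <= C + tail f i + \sum_k e k.
    apply: le_trans (inY_le_tail yY i) _; rewrite -addrA lerD2l.
    apply: (@le_trans _ _ (tail f i + tail e i)); last by rewrite lerD2l partial_le.
    by rewrite -big_split /=; apply: ler_sum.
  by case: (leP (y i + head e i) (C + tail f i)) => h; apply/andP; split; lra.
split; [|split] => [i|i k ki|i iN].
- have h1' : 0 <= head e i by apply: sumr_ge0.
  have := C0; have := yd i; have := d0 i; have := tail_ge0 i f0.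
  by case: (leP (y i + head e i) (C + tail f i)) => h; lra.
- have := yc i k ki; rewrite (headS e ki) (tailS f ki) -/(f i).
  have : e i = c i * `|la i - la' i| by [].
  have := ef i.
  case: (leP (y k + head e k) (C + (f i + tail f i))) => h1;
  case: (leP (y i + (head e k + e i)) (C + tail f i)) => h2; lra.
- by rewrite tail_last // addr0 ge_min lexx orbT.
Qed.

End dual_polytope.

(** * Rounding to binary vectors *)

Definition round {R : realType} (t : R) : R := if 2^-1 <= t then 1 else 0.

Lemma round01 {R : realType} (t : R) : round t = 0 \/ round t = 1.
Proof. by rewrite /round; case: ifP; [right|left]. Qed.

(** The distance is the smaller of [t] and [1 - t], and the larger one is at least 1/2. *)
Lemma round_dist {R : realType} (t : R) : 0 <= t <= 1 -> `|t - round t| <= 2 * (t * (1 - t)).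
Proof.
move=> /andP[t0 t1]; rewrite /round; case: (leP 2^-1 t) => h.
  have -> : `|t - 1| = 1 - t by rewrite distrC ger0_norm // subr_ge0.
  have : 0 <= (1 - t) * (2 * t - 1) by rewrite mulr_ge0; lra.
  lra.
rewrite subr0 ger0_norm //.
have : 0 <= t * (1 - 2 * t) by rewrite mulr_ge0; lra.
lra.
Qed.

(** For binary [la] the left side is an integer, and an integer below [K + 1] is at most [K]. *)
Lemma sum_compl_le {R : realType} {n K : nat} (la : 'I_n -> R) (e : R) :
  (forall i, la i = 0 \/ la i = 1) -> \sum_i (1 - la i) <= K%:R + e -> e < 1 ->
  \sum_i (1 - la i) <= K%:R.
Proof.
move=> la01 le e1.
have E : \sum_i (1 - la i) = (\sum_i nat_of_bool (la i == 0%R))%N%:R.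
  rewrite natr_sum; apply: eq_bigr => i _.
  by case: (la01 i) => ->; rewrite ?eqxx ?oner_eq0 ?subr0 ?subrr.
rewrite E ler_nat -ltnS -(ltr_nat R) -E.
apply: le_lt_trans le _; rewrite -natr1; lra.
Qed.

Section penalty.
Context {R : realType} {n : nat} (K : nat) (uL uU : 'I_n -> R) (c d : 'I_n -> R) (C : R).
Context (s : 'I_n -> R) (xh : XiT R n).
Hypotheses (c0 : forall i, 0 <= c i) (d0 : forall i, 0 <= d i) (C0 : 0 <= C).
Hypothesis u0 : forall i, 0 <= uL i /\ uL i < uU i.
Implicit Types mu la y : 'I_n -> R.

Let h mu y := \sum_i (mu i - s i) * y i.
Let box mu la := forall i, uL i * la i <= mu i /\ mu i <= uU i * la i.
Let unit la := forall i, 0 <= la i <= 1.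

Let U0 i : 0 <= uU i. Proof. by have [/le_trans h1 /ltW] := u0 i; exact: h1. Qed.

Let mu_ge0 mu la : unit la -> box mu la -> forall i, 0 <= mu i <= \sum_k uU k.
Proof.
move=> l01 b i; have /andP[l0 l1] := l01 i; have [b1 b2] := b i; have [uL0 _] := u0 i.
apply/andP; split; first by apply: le_trans b1; rewrite mulr_ge0.
apply: le_trans b2 _; apply: (@le_trans _ _ (uU i)); first exact: ler_piMr.
by rewrite (bigD1 i) //= lerDl; apply: sumr_ge0.
Qed.

(** Crude but uniform: it yields finiteness of the worst case and settles points too far from binary
    ones. *)
Lemma dual_obj_bounded : exists H, forall mu la y, unit la -> box mu la -> inY c d C la y -> h mu y <= H.
Proof.
exists (\sum_i (\sum_k uU k + `|s i|) * (C + \sum_k c k + \sum_k d k)) => mu la y l01 b yY.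
apply: ler_sum => i _; apply: le_trans (ler_norm _) _; rewrite normrM.
apply: ler_pM => //; last exact: inY_bounded yY i.
apply: le_trans (ler_normB _ _) _; rewrite lerD2r.
by have /andP[m0 m1] := mu_ge0 l01 b i; rewrite ger0_norm.
Qed.

(** Lipschitz dependence on [lambda] in the l1-norm, for any target [la'] in the unit cube: the box
    for [mu] and the polytope for [y] both move Lipschitz-continuously, and the objective is
    bilinear on bounded sets. *)
Lemma rounding : exists2 L, 0 <= L & forall mu la la' y,
  unit la -> unit la' -> box mu la -> inY c d C la y ->
  exists mu' y', [/\ box mu' la', inY c d C la' y',
    \sum_i `|mu i - mu' i| <= L * \sum_i `|la i - la' i| &
    h mu y <= h mu' y' + L * \sum_i `|la i - la' i|].
Proof.
pose UU := \sum_k uU k; pose CC := \sum_k c k; pose Y := C + CC + \sum_k d k.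
pose S := \sum_i (UU + `|s i|).
have UU0 : 0 <= UU by apply: sumr_ge0.
have CC0 : 0 <= CC by apply: sumr_ge0.
have Y0 : 0 <= Y by rewrite !addr_ge0 //; apply: sumr_ge0.
have S0 : 0 <= S by apply: sumr_ge0 => i _; rewrite addr_ge0.
(* [UU] bounds the move of [mu]. In the objective, [UU * Y] pays for changing [mu] against the
   bounded [y], and [S * CC] for changing [y] against [mu' - s]. *)
exists (UU + (UU * Y + S * CC)); first by rewrite !addr_ge0 ?mulr_ge0.
move=> mu la la' y l01 l01' b yY; set dl := \sum_i _.
have dl0 : 0 <= dl by apply: sumr_ge0.
have la'0 i : 0 <= la' i by case/andP: (l01' i).
have [y' y'Y yy'] := inY_perturb c0 d0 C0 la'0 yY.
(* [mu] clamped into the interval that [la'] prescribes. *)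
pose mu' i := Num.max (uL i * la' i) (Num.min (mu i) (uU i * la' i)).
have LU i : uL i * la' i <= uU i * la' i.
  by rewrite ler_wpM2r //; have [_ /ltW] := u0 i.
have b' : box mu' la'.
  move=> i; rewrite /mu'; split; first by rewrite le_max lexx.
  by rewrite ge_max LU /= ge_min lexx orbT.
have dist_le i : `|la i - la' i| <= dl.
  by rewrite /dl (bigD1 i) //= lerDl; apply: sumr_ge0.
have mumu i : `|mu i - mu' i| <= uU i * `|la i - la' i|.
  have [b1 b2] := b i; have [uL0 /ltW uLU] := u0 i.
  have E1 : uU i * (la i - la' i) <= uU i * `|la i - la' i| by rewrite ler_wpM2l // ler_norm.
  have E2 : uL i * (la' i - la i) <= uU i * `|la i - la' i|.
    apply: (@le_trans _ _ (uL i * `|la i - la' i|)); first by rewrite ler_wpM2l // distrC ler_norm.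
    by rewrite ler_wpM2r.
  have E3 : 0 <= uU i * `|la i - la' i| by rewrite mulr_ge0.
  have := LU i; rewrite ler_norml /mu' => E4.
  case: (leP (mu i) (uU i * la' i)) => k1.
    by case: (leP (uL i * la' i) (mu i)) => k2; apply/andP; split; lra.
  by rewrite max_r //; apply/andP; split; lra.
have sum_mu : \sum_i `|mu i - mu' i| <= UU * dl.
  apply: (@le_trans _ _ (\sum_i uU i * dl)); last by rewrite -mulr_suml.
  apply: ler_sum => i _; apply: le_trans (mumu i) _.
  by rewrite ler_wpM2l.
have yy i : `|y i - y' i| <= CC * dl.
  apply: le_trans (yy' i) _; rewrite mulr_suml; apply: ler_sum => k _.
  by rewrite ler_wpM2l.
exists mu', y'; split=> //.
  by apply: le_trans sum_mu _; rewrite ler_wpM2r // lerDl addr_ge0 ?mulr_ge0.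
have : h mu y - h mu' y' <= (UU * Y + S * CC) * dl.
  rewrite /h -sumrB.
  apply: (@le_trans _ _ (\sum_i (`|mu i - mu' i| * Y + (UU + `|s i|) * (CC * dl)))).
    apply: ler_sum => i _.
    have -> : (mu i - s i) * y i - (mu' i - s i) * y' i =
      (mu i - mu' i) * y i + (mu' i - s i) * (y i - y' i) by ring.
    apply: lerD; apply: le_trans (ler_norm _) _; rewrite normrM; apply: ler_pM => //.
      exact: inY_bounded yY i.
    apply: le_trans (ler_normB _ _) _; rewrite lerD2r.
    by have /andP[m0 m1] := mu_ge0 l01' b' i; rewrite ger0_norm.
  rewrite big_split /= -!mulr_suml mulrDl mulrA; apply: lerD => //.
  by rewrite mulrAC ler_wpM2r.
have : 0 <= UU * dl by rewrite mulr_ge0.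
rewrite mulrDl; lra.
Qed.

Let ph := xmu xh.
Let lh := xlam xh.

(** A point near a binary one is compared with its rounding, where the hypothesis on [Xi] applies; a
    far one has a penalty sum of at least 1/2. *)
Lemma exact_penalty2 (rho beta : R) : 0 <= rho -> inXi K uL uU xh ->
  (forall x y, inXi K uL uU x -> inY c d C (xlam x) y ->
     dual_obj s x y - rho * costp 2 x xh <= beta) ->
  exists M, forall mu la y, unit la -> box mu la -> \sum_i (1 - la i) <= K%:R ->
    inY c d C la y ->
    h mu y - rho * (\sum_i (mu i - ph i) ^+ 2 + \sum_i (la i - lh i) ^+ 2)
      <= beta + M * \sum_i la i * (1 - la i).
Proof.
move=> rho0 [[lh01 _] bh] Hb.
have [L L0 LP] := rounding; have [H HP] := dual_obj_bounded.
pose UU := \sum_k uU k.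
have UU0 : 0 <= UU by apply: sumr_ge0.
have uh : unit lh by move=> i; case: (lh01 i); rewrite /lh => ->; rewrite ?lexx ler01.
(* With [dl <= 2 * pen], the first summand pays for rounding: [L] for the objective, [2 * UU * L]
   and 2 for the squares in [mu] and [lambda], whose factors are at most [2 * UU] and 2. The second
   exceeds [|H| + |beta|] once [pen >= 1/2]. *)
pose M := 2 * (L + rho * (2 * UU * L + 2)) + 2 * (`|H| + `|beta|).
exists M => mu la y l01 b sK yY.
pose la' i := round (la i).
pose pen := \sum_i la i * (1 - la i); rewrite -/pen.
set dl := \sum_i `|la i - la' i|.
have dpen : dl <= 2 * pen.
  by rewrite /pen mulr_sumr; apply: ler_sum => i _; exact: round_dist.
have dl0 : 0 <= dl by apply: sumr_ge0.
have [d1|d1] := ltP dl 1; last first.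
  have h1 := HP _ _ _ l01 b yY.
  have q0 : 0 <= rho * (\sum_i (mu i - ph i) ^+ 2 + \sum_i (la i - lh i) ^+ 2).
    by rewrite mulr_ge0 // addr_ge0 //; apply: sumr_ge0 => i _; exact: sqr_ge0.
  have q1 : (`|H| + `|beta|) * 1 <= (`|H| + `|beta|) * (2 * pen).
    by rewrite ler_wpM2l ?addr_ge0 //; lra.
  have q2 : 0 <= 2 * (L + rho * (2 * UU * L + 2)) * pen.
    by rewrite !mulr_ge0 ?addr_ge0 ?mulr_ge0 ?addr_ge0 ?mulr_ge0 //; lra.
  have := ler_norm H; have := ler_norm (- beta); rewrite normrN /M.
  lra.
have la'01 i : la' i = 0 \/ la' i = 1 by exact: round01.
have ul' : unit la' by move=> i; case: (la'01 i) => ->; rewrite ?lexx ler01.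
have sK' : \sum_i (1 - la' i) <= K%:R.
  apply: (sum_compl_le la'01 _ d1).
  apply: (@le_trans _ _ (\sum_i ((1 - la i) + `|la i - la' i|))).
    by apply: ler_sum => i _; have := ler_norm (la i - la' i); lra.
  by rewrite big_split /= lerD2r.
have [mu' [y' [b' y'Y dmu hle]]] := LP _ _ _ _ l01 ul' b yY.
pose x : XiT R n := ([tuple mu' i | i < n], [tuple la' i | i < n]).
have xmuE i : xmu x i = mu' i by rewrite /xmu tnth_mktuple.
have xlamE : xlam x = la' by apply/funext => i; rewrite /xlam tnth_mktuple.
have xXi : inXi K uL uU x.
  by split; [split; rewrite xlamE|move=> i; rewrite xlamE xmuE; exact: b'].
have := Hb x y' xXi; rewrite xlamE => /(_ y'Y).
rewrite /dual_obj /costp.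
under eq_bigr do rewrite xmuE.
under [X in _ - _ * (X + _)]eq_bigr do rewrite xmuE real_normK ?num_real //.
under [X in _ - _ * (_ + X)]eq_bigr do rewrite xlamE real_normK ?num_real //.
rewrite -/(h mu' y') -/ph -/lh => Hx.
have mub i : 0 <= mu i <= UU by exact: mu_ge0 l01 b i.
have mub' i : 0 <= mu' i <= UU by exact: mu_ge0 ul' b' i.
have phb i : 0 <= ph i <= UU by exact: mu_ge0 uh bh i.
have Q1 : \sum_i (mu' i - ph i) ^+ 2 - \sum_i (mu i - ph i) ^+ 2 <= 2 * UU * (L * dl).
  rewrite -sumrB; apply: (@le_trans _ _ (\sum_i 2 * UU * `|mu i - mu' i|)); last first.
    by rewrite -mulr_sumr ler_wpM2l // mulr_ge0.
  apply: ler_sum => i _.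
  have -> : (mu' i - ph i) ^+ 2 - (mu i - ph i) ^+ 2 =
    (mu' i + mu i - 2 * ph i) * (mu' i - mu i) by ring.
  apply: le_trans (ler_norm _) _; rewrite normrM [`|mu' i - mu i|]distrC ler_wpM2r //.
  rewrite ler_norml; have := mub i; have := mub' i; have := phb i.
  move: (ph i) (mu i) (mu' i) (UU) => p1 p2 p3 p4 /andP[? ?] /andP[? ?] /andP[? ?].
  by apply/andP; split; lra.
have Q2 : \sum_i (la' i - lh i) ^+ 2 - \sum_i (la i - lh i) ^+ 2 <= 2 * dl.
  rewrite -sumrB mulr_sumr; apply: ler_sum => i _.
  have -> : (la' i - lh i) ^+ 2 - (la i - lh i) ^+ 2 =
    (la' i + la i - 2 * lh i) * (la' i - la i) by ring.
  apply: le_trans (ler_norm _) _; rewrite normrM [`|la' i - la i|]distrC ler_wpM2r //.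
  rewrite ler_norml; have := l01 i; have := ul' i; have := uh i.
  move: (lh i) (la i) (la' i) => p1 p2 p3 /andP[? ?] /andP[? ?] /andP[? ?].
  by apply/andP; split; lra.
have Q3 : rho * (\sum_i (mu' i - ph i) ^+ 2 + \sum_i (la' i - lh i) ^+ 2) <=
   rho * (\sum_i (mu i - ph i) ^+ 2 + \sum_i (la i - lh i) ^+ 2 + (2 * UU * (L * dl) + 2 * dl)).
  by rewrite ler_wpM2l //; lra.
have Q4 : (L + rho * (2 * UU * L + 2)) * dl <= (L + rho * (2 * UU * L + 2)) * (2 * pen).
  by rewrite ler_wpM2l // ?addr_ge0 ?mulr_ge0 ?addr_ge0 ?mulr_ge0.
have Q5 : 0 <= 2 * (`|H| + `|beta|) * pen by rewrite !mulr_ge0 ?addr_ge0 //; lra.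
rewrite -/dl in hle; rewrite /M; lra.
Qed.

(** The positive and negative parts may overlap. The triangle inequality still bounds the l1-cost of
    the rounded point by the sum of the parts plus a multiple of the rounding error. *)
Lemma exact_penalty1 (rho beta : R) : 0 <= rho -> inXi K uL uU xh ->
  (forall x y, inXi K uL uU x -> inY c d C (xlam x) y ->
     dual_obj s x y - rho * costp 1 x xh <= beta) ->
  exists M, forall mup mum lap lam y,
    let la i := lap i - lam i + lh i in let mu i := mup i - mum i + ph i in
    (forall i, 0 <= mup i /\ 0 <= mum i) -> unit lap -> unit lam ->
    unit la -> box mu la -> \sum_i (1 - la i) <= K%:R -> inY c d C la y ->
    h mu y - rho * (\sum_i mup i + \sum_i mum i + \sum_i lap i + \sum_i lam i)
      <= beta + M * (\sum_i lap i * (1 - lap i) + \sum_i lam i * (1 - lam i)).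
Proof.
move=> rho0 [[lh01 _] bh] Hb.
have [L L0 LP] := rounding; have [H HP] := dual_obj_bounded.
pose M := 2 * (L + rho * (L + 1)) + 2 * (`|H| + `|beta|).
exists M => mup mum lap lam y la mu m0 up um l01 b sK yY.
pose lap' i := round (lap i); pose lam' i := round (lam i).
pose la' i := lap' i - lam' i + lh i.
pose pen := \sum_i lap i * (1 - lap i) + \sum_i lam i * (1 - lam i); rewrite -/pen.
pose dp := \sum_i `|lap i - lap' i|; pose dm := \sum_i `|lam i - lam' i|.
have dpen : dp + dm <= 2 * pen.
  by rewrite /pen mulrDr !mulr_sumr; apply: lerD; apply: ler_sum => i _; exact: round_dist.
have dp0 : 0 <= dp by apply: sumr_ge0.
have dm0 : 0 <= dm by apply: sumr_ge0.
have cost0 : 0 <= \sum_i mup i + \sum_i mum i + \sum_i lap i + \sum_i lam i.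
  rewrite !addr_ge0 //; apply: sumr_ge0 => i _; try by case: (m0 i).
    by case/andP: (up i).
  by case/andP: (um i).
have [d1|d1] := ltP (dp + dm) 1; last first.
  have h1 := HP _ _ _ l01 b yY.
  have q0 := mulr_ge0 rho0 cost0.
  have q1 : (`|H| + `|beta|) * 1 <= (`|H| + `|beta|) * (2 * pen).
    by rewrite ler_wpM2l ?addr_ge0 //; lra.
  have q2 : 0 <= 2 * (L + rho * (L + 1)) * pen.
    apply: mulr_ge0; last lra.
    by rewrite mulr_ge0 // addr_ge0 // mulr_ge0 // addr_ge0.
  have := ler_norm H; have := ler_norm (- beta); rewrite normrN /M.
  lra.
have dla i : `|la i - la' i| <= `|lap i - lap' i| + `|lam i - lam' i|.
  have -> : la i - la' i = (lap i - lap' i) - (lam i - lam' i) by rewrite /la /la'; ring.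
  exact: ler_normB.
set dl := \sum_i `|la i - la' i|.
have dlE : dl <= dp + dm by rewrite /dp /dm -big_split /=; apply: ler_sum.
(* [la'] is an integer at distance less than 1 from a point of [0, 1], hence 0 or 1. *)
have la'01 i : la' i = 0 \/ la' i = 1.
  have : `|la i - la' i| < 1.
    apply: le_lt_trans d1; apply: le_trans dlE.
    by rewrite /dl (bigD1 i) //= lerDl; apply: sumr_ge0.
  rewrite ltr_norml => /andP[]; have /andP[] := l01 i.
  rewrite /la'; case: (round01 (lap i)) => e1; case: (round01 (lam i)) => e2;
    rewrite /lap' /lam' e1 e2; case: (lh01 i) => e3; rewrite /lh e3 => *;
    by [left; lra|right; lra|exfalso; lra].
have ul' : unit la' by move=> i; case: (la'01 i) => ->; rewrite ?lexx ler01.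
have sK' : \sum_i (1 - la' i) <= K%:R.
  apply: (sum_compl_le la'01 _ (le_lt_trans dlE d1)).
  apply: (@le_trans _ _ (\sum_i ((1 - la i) + `|la i - la' i|))).
    by apply: ler_sum => i _; have := ler_norm (la i - la' i); lra.
  by rewrite big_split /= lerD2r.
have [mu' [y' [b' y'Y dmu hle]]] := LP _ _ _ _ l01 ul' b yY.
rewrite -/dl in dmu hle.
pose x : XiT R n := ([tuple mu' i | i < n], [tuple la' i | i < n]).
have xmuE i : xmu x i = mu' i by rewrite /xmu tnth_mktuple.
have xlamE : xlam x = la' by apply/funext => i; rewrite /xlam tnth_mktuple.
have xXi : inXi K uL uU x.
  by split; [split; rewrite xlamE|move=> i; rewrite xlamE xmuE; exact: b'].
have := Hb x y' xXi; rewrite xlamE => /(_ y'Y).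
rewrite /dual_obj /costp.
under eq_bigr do rewrite xmuE.
under [X in _ - _ * (X + _)]eq_bigr do rewrite xmuE expr1.
under [X in _ - _ * (_ + X)]eq_bigr do rewrite xlamE expr1.
rewrite -/(h mu' y') -/ph -/lh => Hx.
have Q1 : \sum_i `|mu' i - ph i| <= \sum_i mup i + \sum_i mum i + L * dl.
  apply: le_trans (lerD (lexx _) dmu); rewrite -!big_split /=; apply: ler_sum => i _.
  have -> : mu' i - ph i = mup i - mum i - (mu i - mu' i) by rewrite /mu; ring.
  apply: le_trans (ler_normB _ _) _; rewrite lerD2r.
  apply: le_trans (ler_normB _ _) _; have [? ?] := m0 i.
  by rewrite !ger0_norm.
have Q2 : \sum_i `|la' i - lh i| <= \sum_i lap i + \sum_i lam i + (dp + dm).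
  rewrite /dp /dm -!big_split /=; apply: ler_sum => i _.
  have -> : la' i - lh i = lap' i - lam' i by rewrite /la'; ring.
  apply: le_trans (ler_normB _ _) _.
  have rn t : `|round t| = round t :> R by case: (round01 t) => ->; rewrite ?normr0 ?normr1.
  rewrite /lap' /lam' !rn.
  have := ler_norm (round (lap i) - lap i); have := ler_norm (round (lam i) - lam i).
  by rewrite ![`|round _ - _|]distrC; lra.
have Q0 : L * dl <= L * (dp + dm) by rewrite ler_wpM2l.
have Q3 : rho * (\sum_i `|mu' i - ph i| + \sum_i `|la' i - lh i|) <=
   rho * (\sum_i mup i + \sum_i mum i + \sum_i lap i + \sum_i lam i + (L + 1) * (dp + dm)).
  by rewrite ler_wpM2l //; lra.
have Q4 : (L + rho * (L + 1)) * (dp + dm) <= (L + rho * (L + 1)) * (2 * pen).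
  by rewrite ler_wpM2l // ?addr_ge0 ?mulr_ge0 ?addr_ge0.
have Q5 : 0 <= 2 * (`|H| + `|beta|) * pen.
  by apply: mulr_ge0; [rewrite mulr_ge0 // addr_ge0|lra].
rewrite /M; lra.
Qed.

End penalty.

(** * Copositive matrices *)

Section quadratic_form.
Context {R : realType} {k : nat}.
Implicit Types (M : 'M[R]_k) (x : 'cV[R]_k).

Definition qf M x : R := (x^T *m M *m x) ord0 ord0.

Lemma qfE M x : qf M x = \sum_i \sum_j x i ord0 * M i j * x j ord0.
Proof.
rewrite /qf mxE exchange_big /=; apply: eq_bigr => j _.
by rewrite mxE mulr_suml; apply: eq_bigr => i _; rewrite mxE.
Qed.

Lemma qfD M M' x : qf (M + M') x = qf M x + qf M' x.
Proof. by rewrite /qf mulmxDr mulmxDl mxE. Qed.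

Lemma qfN M x : qf (- M) x = - qf M x.
Proof. by rewrite /qf mulmxN mulNmx mxE. Qed.

Lemma qfZ a M x : qf (a *: M) x = a * qf M x.
Proof. by rewrite /qf -scalemxAr -scalemxAl mxE. Qed.

Lemma qf_sum (I : finType) (M : I -> 'M[R]_k) x : qf (\sum_i M i) x = \sum_i qf (M i) x.
Proof. by rewrite /qf mulmx_sumr mulmx_suml summxE. Qed.

Lemma qf_delta a b x : qf (delta_mx a b) x = x a ord0 * x b ord0.
Proof.
rewrite qfE (bigD1 a) //= [X in _ + X]big1 ?addr0; last first.
  by move=> i /negbTE ia; rewrite big1 // => j _; rewrite mxE ia mulr0 mul0r.
rewrite (bigD1 b) //= mxE !eqxx mulr1 big1 ?addr0 //.
by move=> j /negbTE jb; rewrite mxE jb andbF mulr0 mul0r.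
Qed.

Lemma qf_symE a b x : qf (symE a b) x = 2 * (x a ord0 * x b ord0).
Proof. by rewrite qfD !qf_delta; ring. Qed.

Lemma qf_scale M a x : qf M (a *: x) = a ^+ 2 * qf M x.
Proof.
rewrite !qfE mulr_sumr; apply: eq_bigr => i _; rewrite mulr_sumr; apply: eq_bigr => j _.
by rewrite !mxE; ring.
Qed.

Lemma qf_continuous M : continuous (qf M).
Proof.
move=> x; rewrite (_ : qf M = fun x => \sum_i \sum_j x i ord0 * M i j * x j ord0); last first.
  by apply/funext => ?; exact: qfE.
have sumc (f : 'I_k -> 'cV[R]_k -> R) :
    (forall i, continuous (f i)) -> continuous (fun y => \sum_i f i y).
  by move=> fc; apply: continuous_big => //; exact: add_continuous.
apply: (sumc) => i x1; apply: (sumc) => j {x1} x1.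
have ci := @coord_continuous R k 1 i ord0 x1.
exact: cvgM (cvgM ci (cvg_cst _)) (@coord_continuous R k 1 j ord0 x1).
Qed.

End quadratic_form.

(** Homogeneity of degree 2 reduces the open cone to its slice t = 1, and continuity passes to the
    closure. *)
Lemma COP_persp {R : realType} {k : nat} (F : 'cV[R]_k.+1 -> Prop) (M : 'M[R]_k.+1) :
  COP (persp F) M <->
  M^T = M /\ forall x : 'cV[R]_k.+1, x ord0 ord0 = 1 -> F x -> 0 <= qf M x.
Proof.
split=> -[MT MP]; split=> // x.
  move=> x1 Fx; apply: MP; apply: subset_closure.
  by rewrite /= x1 ltr01 invr1 scale1r.
rewrite -/(qf M x) => xK.
have cl : closed [set y | 0 <= qf M y].
  rewrite (_ : [set y | _] = qf M @^-1` [set r | 0 <= r]) //.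
  by apply: preimage_closed; [move=> y _; exact: qf_continuous|exact: closed_ge].
have sub : [set v : 'cV[R]_k.+1 | 0 < v ord0 ord0 /\ F ((v ord0 ord0)^-1 *: v)]
   `<=` [set y | 0 <= qf M y].
  move=> v /= [v0 Fv].
  have := MP _ _ Fv; rewrite mxE mulVf ?gt_eqF // => /(_ erefl).
  by rewrite qf_scale pmulr_rge0 // exprn_gt0 // invr_gt0.
by have := closure_subset sub xK; rewrite -(closure_id _).1.
Qed.

(** * Block coordinates and evaluation of the matrices *)

Section block_vectors.
Context {R : realType} {n : nat}.

Lemma val_bix m b (r : 'I_n) : (b < m)%N -> bix m b r = (1 + b * n + r)%N :> nat.
Proof.
move=> bm; rewrite /bix inordK // add1n addSn ltnS.
apply: (@leq_trans (b.+1 * n)); last by rewrite leq_mul2r bm orbT.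
by rewrite mulSn [(n + _)%N]addnC ltn_add2l.
Qed.

(** Inverse to [bix]: coordinate k > 0 is entry [(k - 1) mod n] of block [(k - 1) / n]. Its
    existence forces [n > 0], so the final default 0 is never reached. *)
Definition blocks (m : nat) (f : nat -> 'I_n -> R) : 'cV[R]_((m * n).+1) :=
  \col_k (if k == ord0 then 1
          else if insub (k.-1 %% n)%N is Some r then f (k.-1 %/ n)%N r else 0).

Lemma blocks0 m f : blocks m f ord0 ord0 = 1.
Proof. by rewrite mxE. Qed.

Lemma comp_blocks m f b (r : 'I_n) : (b < m)%N -> Defs.comp (blocks m f) b r = f b r.
Proof.
move=> bm; have n0 : (0 < n)%N by apply: leq_ltn_trans (ltn_ord r).
rewrite /Defs.comp mxE -val_eqE /= ifF; last by rewrite val_bix.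
rewrite val_bix //= add0n.
rewrite divnMDl // modnMDl divn_small ?modn_small ?ltn_ord // addn0 insubT //=.
by move=> h; congr (f b _); apply: val_inj.
Qed.

End block_vectors.

Lemma qf_Jmat {R : realType} {k : nat} (i : 'I_k.+1) (x : 'cV[R]_k.+1) :
  qf (Jmat (delta_mx i ord0)) x = x i ord0 ^+ 2 - x i ord0 * x ord0 ord0.
Proof.
rewrite /Jmat /e1v !trmx_delta !mul_delta_mx !(qfD, qfN, qfZ) !qf_delta; by field.
Qed.

Lemma Jmat_tr {R : realType} {k : nat} (a : 'cV[R]_k.+1) : (Jmat a)^T = Jmat a.
Proof.
by rewrite /Jmat !(linearB, linearZ) /= !trmx_mul !trmxK addrAC.
Qed.

Lemma symE_tr {R : realType} {k : nat} (a b : 'I_k) : (symE a b)^T = symE a b :> 'M[R]_k.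
Proof. by rewrite /symE linearD /= !trmx_delta addrC. Qed.

Section symmetric_matrices.
Context {R : realType} {k : nat}.
Implicit Types A B : 'M[R]_k.

Lemma trmx_fixD A B : A^T = A -> B^T = B -> (A + B)^T = A + B.
Proof. by move=> AT BT; rewrite linearD /= AT BT. Qed.

Lemma trmx_fixN A : A^T = A -> (- A)^T = - A.
Proof. by move=> AT; rewrite linearN /= AT. Qed.

Lemma trmx_fixZ a A : A^T = A -> (a *: A)^T = a *: A.
Proof. by move=> AT; rewrite linearZ /= AT. Qed.

Lemma trmx_fix_sum (I : finType) (F : I -> 'M[R]_k) :
  (forall i, (F i)^T = F i) -> (\sum_i F i)^T = \sum_i F i.
Proof. by move=> FT; rewrite linear_sum; apply: eq_bigr => i _; exact: FT. Qed.

End symmetric_matrices.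

Section copositive.
Context {R : realType} {n N : nat} (K : nat) (uL uU : 'I_n -> R) (xihat : 'I_N -> XiT R n).
Context (c d : 'I_n -> R) (C : R) (s : 'I_n -> R) (j : 'I_N) (rho beta : R).

Lemma qf_G1 (x : 'cV[R]_((5 * n).+1)) : x ord0 ord0 = 1 ->
  qf (G1 xihat j rho s) x =
  \sum_r (Defs.comp x 0 r - Defs.comp x 1 r + xmu (xihat j) r - s r) * Defs.comp x 4 r -
  rho * (\sum_r Defs.comp x 0 r + \sum_r Defs.comp x 1 r + \sum_r Defs.comp x 2 r + \sum_r Defs.comp x 3 r).
Proof.
move=> x1; rewrite /G1 !(qfD, qfN, qfZ, qf_sum) !big_ord_recl big_ord0 addr0.
rewrite !qf_sum.
under eq_bigr do rewrite qf_symE x1 mul1r.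
under [X in _ + (X + _)]eq_bigr do rewrite qf_symE x1 mul1r.
under [X in _ + (_ + (X + _))]eq_bigr do rewrite qf_symE x1 mul1r.
under [X in _ + (_ + (_ + X))]eq_bigr do rewrite qf_symE x1 mul1r.
under [X in _ + X + _ - _]eq_bigr do rewrite qfZ qf_symE x1 mul1r.
under [X in _ + _ + _ * X - _]eq_bigr do rewrite qf_symE.
under [X in _ - _ * X]eq_bigr do rewrite qf_symE.
rewrite -!mulr_sumr /Defs.comp /= /bump /=.
under [X in _ = X - _]eq_bigr do rewrite mulrBl mulrDl mulrBl.
rewrite sumrB big_split /= sumrB.
under [X in _ + X + _ - _]eq_bigr do rewrite mulrA mulfVK ?pnatr_eq0 // mulrBl.
by rewrite sumrB; field.
Qed.

(** The corner and the linear entries of [G2] complete the squares of the Euclidean cost. *)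
Lemma qf_G2 (x : 'cV[R]_((3 * n).+1)) : x ord0 ord0 = 1 ->
  qf (G2 xihat j rho s) x =
  \sum_r (Defs.comp x 0 r - s r) * Defs.comp x 2 r -
  rho * (\sum_r (Defs.comp x 0 r - xmu (xihat j) r) ^+ 2 + \sum_r (Defs.comp x 1 r - xlam (xihat j) r) ^+ 2).
Proof.
move=> x1; rewrite /G2 !(qfD, qfN, qfZ, qf_sum) qf_delta x1.
under [X in _ + X + _ - _ - _ + _]eq_bigr do rewrite qfZ qf_symE x1 mul1r.
under [X in _ + _ + X - _ - _ + _]eq_bigr do rewrite qfZ qf_symE x1 mul1r.
under [X in _ - X - _ + _]eq_bigr do rewrite qfZ qf_symE x1 mul1r.
under [X in _ - _ * X + _]eq_bigr do rewrite qfD !qf_delta.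
under [X in _ + _ * X = _]eq_bigr do rewrite qf_symE.
rewrite /Defs.comp.
under [X in _ = X - _]eq_bigr do rewrite mulrBl.
under [X in _ = _ - _ * (X + _)]eq_bigr do rewrite sqrrB.
under [X in _ = _ - _ * (_ + X)]eq_bigr do rewrite sqrrB.
rewrite !big_split /= !sumrN -!mulr_sumr.
have E1 (m z : 'I_n -> R) : \sum_i rho * m i * (2 * z i) = 2 * rho * \sum_i z i * m i.
  by rewrite mulr_sumr; apply: eq_bigr => i _; ring.
have E2 (z : 'I_n -> R) : \sum_i s i / 2 * (2 * z i) = \sum_i s i * z i.
  by apply: eq_bigr => i _; field.
have E3 (z : 'I_n -> R) : \sum_i z i * z i = \sum_i z i ^+ 2.
  by apply: eq_bigr => i _; rewrite expr2.
have E4 (m z : 'I_n -> R) : \sum_i (z i * m i) *+ 2 = 2 * \sum_i z i * m i.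
  by rewrite mulr_sumr; apply: eq_bigr => i _; ring.
by rewrite !E1 E2 !(E3 (fun i => x _ _)) !E4; field.
Qed.

Definition CP1_matrix (psi phi : 'I_n -> R) : 'M[R]_((5 * n).+1) :=
  beta *: (e1v *m e1v^T) + \sum_(i < n) psi i *: Mm i + \sum_(i < n) phi i *: Jm i
  - G1 xihat j rho s.

Definition CP2_matrix (psi : 'I_n -> R) : 'M[R]_((3 * n).+1) :=
  beta *: (e1v *m e1v^T) + \sum_(i < n) psi i *: Nm i - G2 xihat j rho s.

Lemma CP1_matrix_tr psi phi : (CP1_matrix psi phi)^T = CP1_matrix psi phi.
Proof.
apply: trmx_fixD; [do 2?apply: trmx_fixD|apply: trmx_fixN; do 2?apply: trmx_fixD].
- by apply: trmx_fixZ; rewrite trmx_mul trmxK.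
- by apply: trmx_fix_sum => i; apply: trmx_fixZ; exact: Jmat_tr.
- by apply: trmx_fix_sum => i; apply: trmx_fixZ; exact: Jmat_tr.
- apply: trmx_fixD; last by apply: trmx_fix_sum => r; apply: trmx_fixZ; exact: symE_tr.
  by apply: trmx_fixZ; apply: trmx_fix_sum => b; apply: trmx_fix_sum => r; exact: symE_tr.
- by apply: trmx_fixZ; apply: trmx_fix_sum => r; exact: symE_tr.
- by apply: trmx_fixN; apply: trmx_fixZ; apply: trmx_fix_sum => r; exact: symE_tr.
Qed.

Lemma CP2_matrix_tr psi : (CP2_matrix psi)^T = CP2_matrix psi.
Proof.
apply: trmx_fixD; [apply: trmx_fixD|apply: trmx_fixN; do 5?apply: trmx_fixD].
- by apply: trmx_fixZ; rewrite trmx_mul trmxK.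
- by apply: trmx_fix_sum => i; apply: trmx_fixZ; exact: Jmat_tr.
- by apply: trmx_fixZ; rewrite trmx_delta.
- by apply: trmx_fix_sum => r; apply: trmx_fixZ; exact: symE_tr.
- by apply: trmx_fix_sum => r; apply: trmx_fixZ; exact: symE_tr.
- by apply: trmx_fixN; apply: trmx_fix_sum => r; apply: trmx_fixZ; exact: symE_tr.
- apply: trmx_fixN; apply: trmx_fixZ; apply: trmx_fix_sum => r.
  by apply: trmx_fixD; rewrite trmx_delta.
- by apply: trmx_fixZ; apply: trmx_fix_sum => r; exact: symE_tr.
Qed.

Lemma qf_CP1_matrix psi phi (x : 'cV[R]_((5 * n).+1)) : x ord0 ord0 = 1 ->
  qf (CP1_matrix psi phi) x =
  beta + \sum_i psi i * (Defs.comp x 3 i ^+ 2 - Defs.comp x 3 i)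
  + \sum_i phi i * (Defs.comp x 2 i ^+ 2 - Defs.comp x 2 i) - qf (G1 xihat j rho s) x.
Proof.
move=> x1; rewrite /CP1_matrix /e1v trmx_delta mul_delta_mx !(qfD, qfN, qfZ, qf_sum) qf_delta x1.
congr (_ + _ + _ - _); first by rewrite !mulr1.
- by apply: eq_bigr => i _; rewrite qfZ qf_Jmat x1 mulr1.
- by apply: eq_bigr => i _; rewrite qfZ qf_Jmat x1 mulr1.
Qed.

Lemma qf_CP2_matrix psi (x : 'cV[R]_((3 * n).+1)) : x ord0 ord0 = 1 ->
  qf (CP2_matrix psi) x =
  beta + \sum_i psi i * (Defs.comp x 1 i ^+ 2 - Defs.comp x 1 i) - qf (G2 xihat j rho s) x.
Proof.
move=> x1; rewrite /CP2_matrix /e1v trmx_delta mul_delta_mx !(qfD, qfN, qfZ, qf_sum) qf_delta x1.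
congr (_ + _ - _); first by rewrite !mulr1.
by apply: eq_bigr => i _; rewrite qfZ qf_Jmat x1 mulr1.
Qed.

Hypothesis xihatXi : inXi K uL uU (xihat j).

(** Split [x - xihat j] into positive and negative parts. For [lambda], a difference of binary
    vectors, both parts are binary, so the terms in [psi] and [phi] vanish whatever their signs. *)
Lemma CP1_sound psi phi : COP (persp (inF1 c d C K uL uU xihat j)) (CP1_matrix psi phi) ->
  forall x y, inXi K uL uU x -> inY c d C (xlam x) y ->
    dual_obj s x y - rho * costp 1 x (xihat j) <= beta.
Proof.
move=> /COP_persp[_ cop] x y [[l01 sK] b] [yd [yc yC]].
pose pos (t : R) := Num.max t 0.
have posB t : pos t - pos (- t) = t.
  by rewrite /pos; case: (leP t 0) => h; [rewrite max_l ?max_r; lra|rewrite max_r; lra].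
have posD t : pos t + pos (- t) = `|t|.
  rewrite /pos; case: (leP t 0) => h; first by rewrite max_l ?ler0_norm; lra.
  by rewrite max_r ?gtr0_norm; lra.
have pos0 t : 0 <= pos t by rewrite le_max lexx orbT.
pose dm i := xmu x i - xmu (xihat j) i; pose dl i := xlam x i - xlam (xihat j) i.
pose v := blocks 5 (fun b i => match b with
  | 0 => pos (dm i) | 1 => pos (- dm i) | 2 => pos (dl i) | 3 => pos (- dl i) | _ => y i end).
have v1 : v ord0 ord0 = 1 by exact: blocks0.
have [[h01 _] _] := xihatXi.
have dl01 i : (pos (dl i) = 0 \/ pos (dl i) = 1) /\ (pos (- dl i) = 0 \/ pos (- dl i) = 1).
  have p0 : pos 0 = 0 by rewrite /pos maxxx.
  have p1 : pos 1 = 1 by rewrite /pos max_l ?ler01.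
  have pN1 : pos (- 1) = 0 by rewrite /pos max_r ?lerN10.
  by rewrite /dl; case: (l01 i) => ->; case: (h01 i) => ->;
    rewrite ?subrr ?subr0 ?sub0r ?opprK ?oppr0 ?p0 ?p1 ?pN1; split; auto.
have laE i : pos (dl i) - pos (- dl i) + xlam (xihat j) i = xlam x i.
  by rewrite posB /dl subrK.
have muE i : pos (dm i) - pos (- dm i) + xmu (xihat j) i = xmu x i.
  by rewrite posB /dm subrK.
have Fv : inF1 c d C K uL uU xihat j v.
  rewrite /inF1 /=.
  have le1 t : t = 0 \/ t = 1 -> t <= 1 :> R by case=> ->; rewrite ?ler01.
  split; first by move=> i; rewrite !comp_blocks //=.
  split.
    by move=> i; rewrite !comp_blocks //= laE; case: (l01 i) => ->; rewrite ?lexx ?ler01.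
  split; first by move=> i; rewrite !comp_blocks //=; have [? ?] := dl01 i; split; exact: le1.
  split; first by under eq_bigr do rewrite !comp_blocks //= laE.
  split; first by move=> i; rewrite !comp_blocks //= laE muE; exact: b.
  split; first by move=> i iN; rewrite !comp_blocks //=; exact: yC.
  split; first by move=> i; rewrite !comp_blocks //=; exact: yd.
  by move=> i k ki; rewrite !comp_blocks //= laE; exact: yc.
have := cop v v1 Fv; rewrite qf_CP1_matrix // qf_G1 //.
have sq0 t : t = 0 \/ t = 1 -> t ^+ 2 - t = 0 :> R.
  by case=> ->; rewrite ?expr0n ?expr1n ?subrr.
rewrite [X in _ + X + _ - _]big1 ?addr0; last first.
  by move=> i _; rewrite comp_blocks //= sq0 ?mulr0 //; case: (dl01 i).
rewrite [X in _ + X - _]big1 ?addr0; last first.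
  by move=> i _; rewrite comp_blocks //= sq0 ?mulr0 //; case: (dl01 i).
under eq_bigr do rewrite !comp_blocks //= muE.
rewrite -/(dual_obj s x y) -!big_split /=.
have -> : \sum_i (Defs.comp v 0 i + Defs.comp v 1 i + Defs.comp v 2 i + Defs.comp v 3 i) =
    costp 1 x (xihat j).
  rewrite /costp -big_split /=; apply: eq_bigr => i _.
  by rewrite !comp_blocks //= !expr1 -!posD; ring.
by rewrite subr_ge0.
Qed.

(** At a binary [lambda] the terms in [psi] vanish, and the quadratic form is the slack of the
    bound. *)
Lemma CP2_sound psi : COP (persp (inF2 c d C K uL uU)) (CP2_matrix psi) ->
  forall x y, inXi K uL uU x -> inY c d C (xlam x) y ->
    dual_obj s x y - rho * costp 2 x (xihat j) <= beta.
Proof.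
move=> /COP_persp[_ cop] x y [[l01 sK] b] yY.
pose v := blocks 3 (fun b i => match b with
  | 0 => xmu x i | 1 => xlam x i | _ => y i end).
have v1 : v ord0 ord0 = 1 by exact: blocks0.
have v0E i : Defs.comp v 0 i = xmu x i by rewrite comp_blocks.
have v1E i : Defs.comp v 1 i = xlam x i by rewrite comp_blocks.
have v2E i : Defs.comp v 2 i = y i by rewrite comp_blocks.
have Fv : inF2 c d C K uL uU v.
  rewrite /inF2 /= (funext v1E) (funext v2E); split=> //; split=> //; split.
    by move=> i; case: (l01 i) => ->; rewrite ?lexx ?ler01.
  by move=> i; rewrite v0E; exact: b.
have := cop v v1 Fv; rewrite qf_CP2_matrix // qf_G2 //.
rewrite [X in _ + X - _]big1 ?addr0; last first.
  by move=> i _; rewrite v1E; case: (l01 i) => ->; rewrite ?expr0n ?expr1n subrr mulr0.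
under eq_bigr do rewrite v0E v2E.
rewrite -/(dual_obj s x y).
have -> : \sum_r (Defs.comp v 0 r - xmu (xihat j) r) ^+ 2 +
   \sum_r (Defs.comp v 1 r - xlam (xihat j) r) ^+ 2 = costp 2 x (xihat j).
  by congr (_ + _); apply: eq_bigr => i _; rewrite ?v0E ?v1E real_normK ?num_real.
by rewrite subr_ge0.
Qed.

Hypotheses (c0 : forall i, 0 <= c i) (d0 : forall i, 0 <= d i) (C0 : 0 <= C).
Hypothesis u0 : forall i, 0 <= uL i /\ uL i < uU i.
Hypothesis rho0 : 0 <= rho.

(** A single penalty weight serves all coordinates: the multiplier [- M] turns [z^2 - z] into
    [M z (1 - z)]. *)
Lemma CP1_complete :
  (forall x y, inXi K uL uU x -> inY c d C (xlam x) y ->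
    dual_obj s x y - rho * costp 1 x (xihat j) <= beta) ->
  exists M, COP (persp (inF1 c d C K uL uU xihat j)) (CP1_matrix (fun=> - M) (fun=> - M)).
Proof.
move=> Hb.
have [M MP] := exact_penalty1 c0 d0 C0 u0 rho0 xihatXi Hb.
exists M; apply/COP_persp; split; first exact: CP1_matrix_tr.
move=> v v1 [m0 [l01 [lpm [sK [b [yC [yd yc]]]]]]].
rewrite qf_CP1_matrix // qf_G1 //.
have := MP (Defs.comp v 0) (Defs.comp v 1) (Defs.comp v 2) (Defs.comp v 3) (Defs.comp v 4).
move=> /(_ _ _ _ l01 b sK (conj yd (conj yc yC))) H.
have {}H := H ltac:(by move=> i; have [? [? _]] := m0 i)
  ltac:(by move=> i; have [_ [_ [? _]]] := m0 i; have [? _] := lpm i; apply/andP)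
  ltac:(by move=> i; have [_ [_ [_ ?]]] := m0 i; have [_ ?] := lpm i; apply/andP).
have E (z : 'I_n -> R) : \sum_i - M * (z i ^+ 2 - z i) = M * \sum_i z i * (1 - z i).
  by rewrite mulr_sumr; apply: eq_bigr => i _; ring.
rewrite !E; lra.
Qed.

Lemma CP2_complete :
  (forall x y, inXi K uL uU x -> inY c d C (xlam x) y ->
    dual_obj s x y - rho * costp 2 x (xihat j) <= beta) ->
  exists M, COP (persp (inF2 c d C K uL uU)) (CP2_matrix (fun=> - M)).
Proof.
move=> Hb.
have [M MP] := exact_penalty2 c0 d0 C0 u0 rho0 xihatXi Hb.
exists M; apply/COP_persp; split; first exact: CP2_matrix_tr.
move=> v v1 [yY [sK [l01 b]]].
rewrite qf_CP2_matrix // qf_G2 //.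
have H := MP _ _ _ l01 b sK yY.
have E (z : 'I_n -> R) : \sum_i - M * (z i ^+ 2 - z i) = M * \sum_i z i * (1 - z i).
  by rewrite mulr_sumr; apply: eq_bigr => i _; ring.
rewrite !E; lra.
Qed.

End copositive.

(** * Equivalence of the two programs *)

(** [P s r] reads: [r] is an objective value of the second program at [s]. The second hypothesis
    asks for an attained [r], so that a minimizer of [W] extends to an optimal solution. *)
Lemma same_inf_and_minimizers {R : realType} {X : Type} (S : X -> Prop) (W : X -> \bar R)
    (P : X -> R -> Prop) (A : set (\bar R)) :
  (forall s r, P s r -> S s /\ (W s <= r%:E)%E) ->
  (forall s, S s -> exists2 r, P s r & (r%:E <= W s)%E) ->
  (forall z, A z <-> exists s r, P s r /\ z = r%:E) ->
  let Z := ereal_inf [set z | exists s, S s /\ z = W s] in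
  Z = ereal_inf A /\
  forall s, (S s /\ W s = Z) <-> exists r, P s r /\ r%:E = ereal_inf A.
Proof.
move=> PW WP AP Z.
have Pinf s r : P s r -> (ereal_inf A <= r%:E)%E.
  by move=> Psr; apply: ereal_inf_lbound; apply/AP; exists s, r.
have Sinf s : S s -> (Z <= W s)%E.
  by move=> Ss; apply: ereal_inf_lbound; exists s.
have ZE : Z = ereal_inf A.
  apply/eqP; rewrite eq_le; apply/andP; split; apply: le_ereal_inf_tmp => z.
    by move=> /AP[s [r [/PW[Ss Wr] ->]]]; exact: le_trans (Sinf s Ss) Wr.
  by move=> [s [/WP[r Psr rW] ->]]; exact: le_trans (Pinf s r Psr) rW.
split=> // s; split=> [[Ss WZ]|[r [Psr rE]]].
  have [r Psr rW] := WP s Ss; exists r; split=> //.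
  by apply/eqP; rewrite eq_le (Pinf s r Psr) andbT -ZE -WZ.
have [Ss Wr] := PW s r Psr; split=> //.
by apply/eqP; rewrite eq_le (Sinf s Ss) andbT ZE -rE.
Qed.

Section reformulation.
Context {R : realType} {n N : nat} (Tcap : R) (c d : 'I_n -> R) (C : R) (uL uU : 'I_n -> R).
Context (K : nat) (xihat : 'I_N -> XiT R n) (eps : R).
Hypotheses (n0 : (0 < n)%N) (N0 : (0 < N)%N) (eps0 : 0 < eps).
Hypotheses (c0 : forall i, 0 <= c i) (d0 : forall i, 0 <= d i) (C0 : 0 <= C).
Hypothesis u0 : forall i, 0 <= uL i /\ uL i < uU i.
Hypothesis xihatXi : forall j, inXi K uL uU (xihat j).

Let lam_ge0 x : inXi K uL uU x -> forall i, 0 <= xlam x i.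
Proof. by move=> [[l01 _] _] i; case: (l01 i) => ->; rewrite ?ler01. Qed.

Let gval_bounded s : exists B, forall x, inXi K uL uU x -> (0 <= gval c d C s x <= B%:E)%E.
Proof.
have [B BP] := dual_obj_bounded s c0 d0 C0 u0.
exists B => x xXi; have l0 := lam_ge0 xXi; apply/andP; split.
  have := gval_ge_dual s n0 c0 d0 C0 (inY0 c0 d0 C0 l0).
  by rewrite /dual_obj big1 // => i _; rewrite mulr0.
have [y yY ->] := gval_dual s n0 c0 d0 C0 l0; rewrite lee_fin.
have [[l01 _] b] := xXi.
by apply: (BP _ _ _ _ b yY) => i; case: (l01 i) => ->; rewrite ?lexx ler01.
Qed.

Lemma worst_le_of_dual p s rho (beta : 'I_N -> R) : (0 < p)%N -> 0 <= rho ->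
  (forall j x y, inXi K uL uU x -> inY c d C (xlam x) y ->
    dual_obj s x y - rho * costp p x (xihat j) <= beta j) ->
  (worst c d C K uL uU xihat p eps s <= (eps ^+ p * rho + N%:R^-1 * \sum_j beta j)%:E)%E.
Proof.
move=> p0 rho0 Hb; apply: worst_le => // [j|x j xXi].
  (* Testing the bound at [xihat j] with [y = 0] shows [beta j >= 0]. *)
  have := Hb j _ _ (xihatXi j) (inY0 c0 d0 C0 (lam_ge0 (xihatXi j))).
  by rewrite costpxx // mulr0 subr0 /dual_obj big1 // => i _; rewrite mulr0.
have [y yY ->] := gval_dual s n0 c0 d0 C0 (lam_ge0 xXi).
by rewrite lee_fin addrC -lerBlDr; exact: Hb.
Qed.

Lemma dual_of_worst p s : (0 < p)%N -> exists rho (beta : 'I_N -> R), [/\ 0 <= rho,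
  (forall j x y, inXi K uL uU x -> inY c d C (xlam x) y ->
    dual_obj s x y - rho * costp p x (xihat j) <= beta j) &
  ((eps ^+ p * rho + N%:R^-1 * \sum_j beta j)%:E <= worst c d C K uL uU xihat p eps s)%E].
Proof.
move=> p0; have [B gB] := gval_bounded s.
have [rho [b [rho0 gb le]]] := worst_dual_attained N0 p0 eps0 xihatXi gB.
exists rho, b; split=> // j x y xXi yY; rewrite lerBlDr addrC -lee_fin.
exact: le_trans (gval_ge_dual s n0 c0 d0 C0 yY) (gb x j xXi).
Qed.

Lemma WNS_CP1 :
  Z_WNS Tcap c d C K uL uU xihat 1 eps = CP1_val Tcap c d C K uL uU xihat eps /\
  forall s : 'I_n -> R,
    WNS_opt Tcap c d C K uL uU xihat 1 eps s <->
    exists rho beta psi phi,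
      CP1_feas Tcap c d C K uL uU xihat rho beta psi phi s /\
      (CP1_obj eps rho beta)%:E = CP1_val Tcap c d C K uL uU xihat eps.
Proof.
pose P s (r : R) := exists rho beta psi phi,
  CP1_feas Tcap c d C K uL uU xihat rho beta psi phi s /\ r = CP1_obj eps rho beta.
have [|||ZE sE] := @same_inf_and_minimizers R _ (inS Tcap) (worst c d C K uL uU xihat 1 eps) P
  [set z | exists rho beta psi phi s,
     CP1_feas Tcap c d C K uL uU xihat rho beta psi phi s /\ z = (CP1_obj eps rho beta)%:E].
- move=> s _ [rho [beta [psi [phi [[cop [rho0 sS]] ->]]]]]; split=> //.
  rewrite /CP1_obj -[in X in X * rho](expr1 eps); apply: worst_le_of_dual => // j.
  exact: (CP1_sound (xihatXi j) (cop j)).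
- move=> s sS; have [rho [beta [rho0 Hb le]]] := dual_of_worst s (isT : (0 < 1)%N).
  have /choice[M MP] j := CP1_complete (xihatXi j) c0 d0 C0 u0 rho0 (Hb j).
  exists (CP1_obj eps rho beta); last by rewrite /CP1_obj -[in X in X * rho](expr1 eps).
  by exists rho, beta, (fun _ j => - M j), (fun _ j => - M j).
- move=> z; split.
    move=> [rho [beta [psi [phi [s [f ->]]]]]]; exists s, (CP1_obj eps rho beta); split=> //.
    by exists rho, beta, psi, phi.
  by move=> [s [_ [[rho [beta [psi [phi [f ->]]]]] ->]]]; exists rho, beta, psi, phi, s.
split=> // s; split.
  by move=> /sE[_ [[rho [beta [psi [phi [f ->]]]]] e]]; exists rho, beta, psi, phi.
move=> [rho [beta [psi [phi [f e]]]]]; apply/sE; exists (CP1_obj eps rho beta); split=> //.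
by exists rho, beta, psi, phi.
Qed.

Lemma WNS_CP2 :
  Z_WNS Tcap c d C K uL uU xihat 2 eps = CP2_val Tcap c d C K uL uU xihat eps /\
  forall s : 'I_n -> R,
    WNS_opt Tcap c d C K uL uU xihat 2 eps s <->
    exists rho beta psi,
      CP2_feas Tcap c d C K uL uU xihat rho beta psi s /\
      (CP2_obj eps rho beta)%:E = CP2_val Tcap c d C K uL uU xihat eps.
Proof.
pose P s (r : R) := exists rho beta psi,
  CP2_feas Tcap c d C K uL uU xihat rho beta psi s /\ r = CP2_obj eps rho beta.
have [|||ZE sE] := @same_inf_and_minimizers R _ (inS Tcap) (worst c d C K uL uU xihat 2 eps) P
  [set z | exists rho beta psi s,
     CP2_feas Tcap c d C K uL uU xihat rho beta psi s /\ z = (CP2_obj eps rho beta)%:E].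
- move=> s _ [rho [beta [psi [[cop [rho0 sS]] ->]]]]; split=> //.
  apply: worst_le_of_dual => // j.
  exact: (CP2_sound (cop j)).
- move=> s sS; have [rho [beta [rho0 Hb le]]] := dual_of_worst s (isT : (0 < 2)%N).
  have /choice[M MP] j := CP2_complete (xihatXi j) c0 d0 C0 u0 rho0 (Hb j).
  exists (CP2_obj eps rho beta); last exact: le.
  by exists rho, beta, (fun _ j => - M j).
- move=> z; split.
    move=> [rho [beta [psi [s [f ->]]]]]; exists s, (CP2_obj eps rho beta); split=> //.
    by exists rho, beta, psi.
  by move=> [s [_ [[rho [beta [psi [f ->]]]] ->]]]; exists rho, beta, psi, s.
split=> // s; split.
  by move=> /sE[_ [[rho [beta [psi [f ->]]]] e]]; exists rho, beta, psi.
move=> [rho [beta [psi [f e]]]]; apply/sE; exists (CP2_obj eps rho beta); split=> //.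
by exists rho, beta, psi.
Qed.

End reformulation.

Theorem theorem6 (R : realType) (n N : nat) (Tcap : R) (c d : 'I_n -> R) (C : R)
  (uL uU : 'I_n -> R) (K : nat) (xihat : 'I_N -> XiT R n) (eps : R) :
  (0 < n)%N -> (0 < N)%N -> 0 < Tcap ->
  (forall i, 0 <= c i) -> (forall i, 0 <= d i) -> 0 <= C ->
  (forall i k : 'I_n, i.+1 = k :> nat -> d k - d i <= c k) ->
  (forall i, 0 <= uL i /\ uL i < uU i) ->
  (1 <= K <= n)%N ->
  0 < eps ->
  (forall j, inXi K uL uU (xihat j)) ->
  (* (i) p = 1 *)
  (Z_WNS Tcap c d C K uL uU xihat 1 eps = CP1_val Tcap c d C K uL uU xihat eps /\
   forall s : 'I_n -> R,
     WNS_opt Tcap c d C K uL uU xihat 1 eps s <->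
     exists rho beta psi phi,
       CP1_feas Tcap c d C K uL uU xihat rho beta psi phi s /\
       (CP1_obj eps rho beta)%:E = CP1_val Tcap c d C K uL uU xihat eps) /\
  (* (ii) p = 2 *)
  (Z_WNS Tcap c d C K uL uU xihat 2 eps = CP2_val Tcap c d C K uL uU xihat eps /\
   forall s : 'I_n -> R,
     WNS_opt Tcap c d C K uL uU xihat 2 eps s <->
     exists rho beta psi,
       CP2_feas Tcap c d C K uL uU xihat rho beta psi s /\
       (CP2_obj eps rho beta)%:E = CP2_val Tcap c d C K uL uU xihat eps).
Proof.
move=> n0 N0 _ c0 d0 C0 _ u0 _ eps0 xihatXi.
by split; [exact: WNS_CP1|exact: WNS_CP2].
Qed.
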